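(* Let $d,k\in\mathbb{N}$, let $Q\subset\mathbb{C}^d$ be a complete circular domain centered at $0\in Q$, let $f(z)=\sum_{n=0}^{\infty}P_n(z)$ (homogeneous polynomial expansion) converge in $Q$, with $a=|f(0)|<1$ and $|f(z)|<1$ for all $z\in Q$, and let $\widehat{\omega}_k\in\mathcal{B}_k$. Then $$\sum_{n=1}^{\infty}|P_n(\widehat{\omega}_k(z))|\le 1$$ in the homothetic domain $(1/\sqrt[2k]{2})\,Q$; that is, $\sum_{n=1}^{\infty}|P_n(b)|\,|\widehat{\omega}_k(h)|^n\le 1$ for every $b\in\mathbb{C}^d$ with $b\mathbb{D}\subset Q$ and every $h\in\mathbb{D}$ with $|h|<1/\sqrt[2k]{2}$. Moreover, if $Q$ is convex, then the number $1/\sqrt[2k]{2}$ is best possible.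
   Context: $\mathbb{D}=\{h\in\mathbb{C}:|h|<1\}$. $\mathcal{B}$ is the set of analytic functions $g$ on $\mathbb{D}$ with $\sup_{\mathbb{D}}|g|\le 1$. For $k\in\mathbb{N}=\{1,2,\dots\}$, $\mathcal{B}_k=\{\omega\in\mathcal{B}:\omega(0)=\omega'(0)=\cdots=\omega^{(k-1)}(0)=0,\ \omega^{(k)}(0)\ne 0\}$ (Schwarz functions). A domain $Q\subset\mathbb{C}^d$ is complete circular (centered at $0\in Q$) if $\lambda z\in Q$ whenever $z\in Q$, $|\lambda|\le 1$. A holomorphic $f$ on $Q$ expands as $f(z)=\sum_{n\ge 0}P_n(z)$ with $P_n(z)=\sum_{|\alpha|=n}A_\alpha z^\alpha$ a homogeneous polynomial of degree $n$ and $P_0=f(0)$. For $R>0$, $RQ=\{Rz:z\in Q\}$. Convention for Schwarz functions on $Q$: restrict to complex lines through the origin. A point of $Q$ is written $z=bh$ with $b\in\mathbb{C}^d$, $b\mathbb{D}:=\{bh:h\in\mathbb{D}\}\subset Q$ and $h\in\mathbb{D}$; then $P_n(\widehat{\omega}(z))$ means $P_n(b\,\widehat{\omega}(h))=P_n(b)\,\widehat{\omega}(h)^n$. An inequality holds in $RQ$ if it holds for all such $b$ and all $|h|<R$. ''Best possible'' means: for every $R'$ with $R<R'\le 1$, where $R$ is the stated number, there exist a function $f$ satisfying the hypotheses on the given $Q$ and a Schwarz function in the stated class for which the inequality does not hold in $R'Q$. (If $Q=\mathbb{C}^d$ all $RQ$ coincide, so the sharpness assertion is understood for $Q\neq\mathbb{C}^d$.)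 *)

(* Defs.v *)
From HB Require Import structures.
From mathcomp Require Import all_boot all_order all_algebra.
From mathcomp Require Import complex.
(* Not imported: the notations of mpoly clash with those of analysis. *)
From mathcomp Require mpoly.
From mathcomp Require Import all_classical all_reals all_analysis.

Set Implicit Arguments.
Unset Strict Implicit.
Unset Printing Implicit Defensive.

Import Order.TTheory GRing.Theory Num.Theory.
Import numFieldNormedType.Exports.

Local Open Scope classical_set_scope.
Local Open Scope ring_scope.

(* The complex numbers, packed as a numClosedFieldType so that the topology
   and the normed module structures of a numFieldType are inferred for it.
   The library norm `|z| lies in Cplx R itself; Normc.normc z is the same
   modulus, as an element of R. *)
Definition Cplx (R : realType) : numClosedFieldType := R[i].

Definition unit_disc (R : realType) : set (Cplx R) :=
  [set h : Cplx R | Normc.normc h < 1].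
Arguments unit_disc : clear implicits.

Definition analytic_on (R : realType) (U : set (Cplx R))
    (g : Cplx R -> Cplx R) : Prop :=
  forall z, U z -> exists c : nat -> Cplx R,
    \forall w \near z,
      (\sum_(n < N) c n * (w - z) ^+ n) @[N --> \oo] --> (g w : Cplx R).

Definition schwarz_class (R : realType) (k : nat) (g : Cplx R -> Cplx R)
    : Prop :=
  [/\ analytic_on (unit_disc R) g,
      forall h, unit_disc R h -> Normc.normc (g h) <= 1,
      forall j, (j < k)%N -> derive1n j g 0 = 0
    & derive1n k g 0 != 0].

Definition complete_circular_domain (R : realType) (d : nat)
    (Q : set 'rV[Cplx R]_d) : Prop :=
  [/\ open Q, connected Q, Q 0
    & forall (l : Cplx R) z, Q z -> Normc.normc l <= 1 -> Q (l *: z)].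

(* mpoly's  p \is n.-homog , whose notation is not available here. *)
Definition homogeneous (R : realType) (d n : nat)
    (p : mpoly.mpoly d (Cplx R)) : bool :=
  p \is mpoly.ishomog1 n (mpoly.mpoly_mdeg__canonical__mpoly_Measure d).

(* mpoly's  p.@[v]  at the entries v of the row vector z. *)
Definition hpeval (R : realType) (d : nat) (p : mpoly.mpoly d (Cplx R))
    (z : 'rV[Cplx R]_d) : Cplx R :=
  mpoly.meval (fun i => z 0 i) p.

(* f = \sum_n P_n is the homogeneous polynomial expansion on Q of the
   holomorphic function f; the values of f outside Q are irrelevant. *)
Definition homogeneous_expansion (R : realType) (d : nat)
    (Q : set 'rV[Cplx R]_d) (f : 'rV[Cplx R]_d -> Cplx R)
    (P : nat -> mpoly.mpoly d (Cplx R)) : Prop :=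
  [/\ forall z, Q z -> differentiable f z,
      forall n, homogeneous n (P n)
    & forall z, Q z ->
        (\sum_(n < N) hpeval (P n) z) @[N --> \oo] --> (f z : Cplx R)].

Definition bounded_expansion (R : realType) (d : nat)
    (Q : set 'rV[Cplx R]_d) (f : 'rV[Cplx R]_d -> Cplx R)
    (P : nat -> mpoly.mpoly d (Cplx R)) : Prop :=
  [/\ homogeneous_expansion Q f P,
      Normc.normc (f 0) < 1
    & forall z, Q z -> Normc.normc (f z) < 1].

(* A point z of Q is written z = b h with h and b D contained in Q; the value
   P_n(omega(z)) is then P_n(b omega(h)). The sum is taken in \bar R, so the
   inequality includes the convergence of the series. *)
Definition bohr_inequality_in (R : realType) (d : nat)
    (Q : set 'rV[Cplx R]_d) (P : nat -> mpoly.mpoly d (Cplx R))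
    (omega : Cplx R -> Cplx R) (r : R) : Prop :=
  forall b : 'rV[Cplx R]_d, (forall h, unit_disc R h -> Q (h *: b)) ->
  forall h, unit_disc R h -> Normc.normc h < r ->
    (\sum_(1 <= n <oo) (Normc.normc (hpeval (P n) (omega h *: b)))%:E <= 1)%E.

(* Main.v *)
Require Import Defs.
From HB Require Import structures.
From mathcomp Require Import all_boot all_order all_algebra.
From mathcomp Require Import complex.
From mathcomp Require mpoly.
From mathcomp Require cyclotomic.
From mathcomp Require Import all_classical all_reals all_analysis.
From mathcomp Require Import ring lra.

(** The inequality. Restricting f to the disc spanned by b gives a power
    series F(h) = \sum c_n h^n, with c_n = P_n(b), converging on the unit disc
    to a function bounded by 1. Averaging |F|^2 over circles gives
    \sum |c_n|^2 s^(2n) <= 1 for every s < 1 (bessel). If 2 rho^2 < 1 there is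
    an s < 1 with (rho/s)^2 <= 1/2, and
      |c_n| rho^n <= (|c_n|^2 s^(2n) + (rho/s)^(2n)) / 2,
    where the right hand sides sum to at most 1 over n >= 1
    (bohr_inequality_disc). By the Schwarz lemma |omega(h)| <= |h|^k
    (schwarz_class_le), and rho = |h|^k satisfies 2 rho^2 < 1 exactly when
    |h| < 2^(-1/(2k)).

    The Schwarz lemma is proved by dividing by h once per order of vanishing:
    the quotient g(h)/h is again analytic, and the maximum principle bounds it
    by sup |g|. The maximum principle itself follows from the averaging
    inequality: at an interior maximum of |G| the local expansion has
    \sum |c_n|^2 s^(2n) <= |c_0|^2, so G is locally constant, which is
    impossible at the maximum point of largest real part.

    Sharpness. Take a = 1/sqrt 2 and the product of z with a Blaschke factor,
      z (a - z) / (1 - a z) = a z - \sum_(n >= 2) a^n z^n,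
    the simplification of the coefficients being due to 1 - a^2 = a^2. It maps
    the disc into itself, and the moduli of its terms sum to
    a rho / (1 - a rho), which exceeds 1 as soon as rho > a. It is transported
    to Q by composing with a linear form L such that sup |L| = 1 over Q and
    |L| < 1 on Q (support_functional). Such an L is a multiple of the
    scalar product with y - p, where y lies outside the closure of Q and p is
    the point of that closure closest to y. *)

Set Implicit Arguments.
Unset Strict Implicit.
Unset Printing Implicit Defensive.

Import Order.TTheory GRing.Theory Num.Theory.
Import numFieldNormedType.Exports.

Local Open Scope classical_set_scope.
Local Open Scope ring_scope.

Local Notation nc := Normc.normc.

(** * Averages over roots of unity *)

Lemma prim_root_exists (C : numClosedFieldType) (n : nat) :
  (0 < n)%N -> exists z : C, n.-primitive_root z.
Proof.
move=> n_gt0; pose p : {poly C} := 'X^n - 1%:P.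
have [r Dp] := closed_field_poly_normal p.
move: Dp; rewrite (monicP _) ?monicXnsubC//; rewrite scale1r => Dp.
have sz_r : size r = n by apply: succn_inj; rewrite -(size_prod_XsubC r idfun) -Dp size_XnsubC.
have /hasP[z _ zP] : has n.-primitive_root r; last by exists z.
apply: cyclic.has_prim_root => //; last by rewrite sz_r.
- by apply/allP => z; rewrite -root_prod_XsubC -Dp /p polyC1.
- rewrite -separable.separable_prod_XsubC -Dp /p polyC1; apply: cyclotomic.separable_Xn_sub_1.
  by rewrite pnatr_eq0 -lt0n.
Qed.

(** A finite substitute for the integral mean of |p|^2 over a circle: the
    characters j |-> z^(j n) for distinct n < N are orthogonal. *)
Lemma parseval_prim_root (C : numClosedFieldType) (N : nat) (z : C) (a : nat -> C) :
  N.-primitive_root z ->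
  \sum_(j < N) `|\sum_(n < N) a n * (z ^+ j) ^+ n| ^+ 2
    = N%:R * \sum_(n < N) `|a n| ^+ 2.
Proof.
move=> zN.
have N_gt0 := prim_order_gt0 zN.
have z0 : z != 0.
  by apply/negP => /eqP z0; have := prim_expr_order zN; rewrite z0 expr0n gtn_eqF//= => /eqP;
     rewrite eq_sym oner_eq0.
have nz : `|z| = 1.
  apply/eqP; rewrite -(@pexpr_eq1 _ _ N)// -normrX (prim_expr_order zN) normr1//.
have cz : Num.conj z = z^-1 by rewrite invC_norm nz expr1n invr1 mul1r.
have ortho (n m : 'I_N) : \sum_(j < N) (z ^+ n * z ^- m) ^+ j = (n == m)%:R * N%:R.
  have [->|nm] := eqVneq n m.
    rewrite mulfV ?expf_neq0// mul1r (eq_bigr (fun=> 1)) ?sumr_const ?card_ord//.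
    by move=> i _; rewrite expr1n.
  set q := z ^+ n * z ^- m; have q1 : q - 1 != 0.
    rewrite subr_eq0 /q; apply: contra nm => /eqP q1.
    have : z ^+ n = z ^+ m.
      by rewrite -[LHS](mulfVK (expf_neq0 m z0)) q1 mul1r.
    by move/eqP; rewrite (eq_prim_root_expr zN) !modn_small.
  apply: (mulfI q1); rewrite -subrX1 mul0r mulr0 /q exprMn exprVn -!exprM.
  by rewrite (mulnC n) (mulnC m) !exprM (prim_expr_order zN) !expr1n invr1 mulr1 subrr.
under eq_bigr => j _.
  rewrite normCK rmorph_sum big_distrlr /=.
  under eq_bigr => n _.
    under eq_bigr => m _.
      have -> : a n * (z ^+ j) ^+ n * Num.conj (a m * (z ^+ j) ^+ m)
          = a n * Num.conj (a m) * (z ^+ n * z ^- m) ^+ j.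
        rewrite rmorphM !rmorphXn /= cz !exprMn !exprVn -!exprM (mulnC n) (mulnC m).
        by rewrite !mulrA; congr (_ * _); rewrite mulrAC.
    over. over. over.
rewrite exchange_big mulr_sumr; apply: eq_bigr => n _ /=.
rewrite exchange_big /= (bigD1 n)//= [X in _ + X]big1 ?addr0 => [|m mn].
  by rewrite -mulr_sumr ortho eqxx mul1r normCK mulrC.
by rewrite -mulr_sumr ortho eq_sym (negbTE mn) mul0r mulr0.
Qed.

(** * The modulus as a real number, and the topology it defines *)

Lemma normE (R : realType) (z : Cplx R) : `|z| = ((nc z)%:C)%C.
Proof. by case: z. Qed.

Lemma nc_ge0 (R : realType) (z : Cplx R) : 0 <= nc z.
Proof. by rewrite -lecR -normE normr_ge0. Qed.

Lemma nc_eq0 (R : realType) (z : Cplx R) : (nc z == 0) = (z == 0).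
Proof. by rewrite -[RHS]normr_eq0 normE -(inj_eq (@complexI R)). Qed.

Lemma nc_gt0 (R : realType) (z : Cplx R) : (0 < nc z) = (z != 0).
Proof. by rewrite lt_def nc_eq0 nc_ge0 andbT. Qed.

Lemma nc0 (R : realType) : nc (0 : Cplx R) = 0.
Proof. exact: Normc.normc0. Qed.

Lemma nc1 (R : realType) : nc (1 : Cplx R) = 1.
Proof. exact: Normc.normc1. Qed.

Lemma ncM (R : realType) (z w : Cplx R) : nc (z * w) = nc z * nc w.
Proof. exact: Normc.normcM. Qed.

Lemma ncV (R : realType) (z : Cplx R) : nc z^-1 = (nc z)^-1.
Proof. exact: Normc.normcV. Qed.

Lemma ncX (R : realType) (z : Cplx R) (n : nat) : nc (z ^+ n) = nc z ^+ n.
Proof. by elim: n => [|n IH]; rewrite ?nc1// !exprS ncM IH. Qed.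

Lemma ncN (R : realType) (z : Cplx R) : nc (- z) = nc z.
Proof. exact: normcN. Qed.

Lemma ncB (R : realType) (z w : Cplx R) : nc (z - w) = nc (w - z).
Proof. by rewrite -ncN opprB. Qed.

Lemma ncD (R : realType) (z w : Cplx R) : nc (z + w) <= nc z + nc w.
Proof. exact: le_normcD. Qed.

Lemma nc_dist (R : realType) (x z w : Cplx R) :
  nc (z - w) <= nc (z - x) + nc (x - w).
Proof. by rewrite (le_trans _ (ncD _ _))// subrKA. Qed.

Lemma nc_le_add_dist (R : realType) (z w : Cplx R) : nc z <= nc w + nc (z - w).
Proof. by rewrite (le_trans _ (ncD _ _))// addrC subrK. Qed.

Lemma nc_sum (R : realType) (I : Type) (s : seq I) (P : pred I)
    (F : I -> Cplx R) :
  nc (\sum_(i <- s | P i) F i) <= \sum_(i <- s | P i) nc (F i).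
Proof.
elim/big_ind2: _ => [|x a y b xa yb|//]; first by rewrite nc0.
by rewrite (le_trans (ncD _ _))// lerD.
Qed.

Lemma nc_real (R : realType) (x : R) : nc (x%:C)%C = `|x|.
Proof. by rewrite /= expr0n /= addr0 sqrtr_sqr. Qed.

Lemma nc_nat (R : realType) (n : nat) : nc (n%:R : Cplx R) = n%:R.
Proof.
rewrite (_ : n%:R = (n%:R%:C)%C :> Cplx R) ?nc_real ?normr_nat//.
by rewrite rmorph_nat.
Qed.

Lemma Cplx_gt0P (R : realType) (e : Cplx R) :
  0 < e -> 0 < complex.Re e /\ e = ((complex.Re e)%:C)%C.
Proof. by case: e => a b; rewrite ltcE /= => /andP[/eqP -> ->]. Qed.

Lemma cvgC_nbhs (R : realType) (T : Type) (F : set_system T) (FF : Filter F)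
    (u : T -> Cplx R) (l : Cplx R) :
  u @ F --> l <-> forall e : R, 0 < e -> \forall x \near F, nc (l - u x) < e.
Proof.
split=> [/cvgrPdist_lt ul e e0|ul].
  have := ul (e%:C)%C; rewrite ltcR => /(_ e0).
  by apply: filterS => x; rewrite normE ltcR.
apply/cvgrPdist_lt => e /Cplx_gt0P[e0 ->].
by near=> x; rewrite normE ltcR; near: x; exact: ul.
Unshelve. all: by end_near. Qed.

Lemma cvgnCP (R : realType) (u : nat -> Cplx R) (l : Cplx R) :
  u @ \oo --> l <->
  forall e : R, 0 < e -> exists N, forall n, (N <= n)%N -> nc (l - u n) < e.
Proof.
rewrite cvgC_nbhs; split=> ul e e0.
  by have [N _ NP] := ul e e0; exists N => n Nn; exact: NP.
by have [N NP] := ul e e0; exists N.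
Qed.

Lemma nbhsCP (R : realType) (z : Cplx R) (P : set (Cplx R)) :
  nbhs z P <-> exists2 e : R, 0 < e & forall w, nc (w - z) < e -> P w.
Proof.
split=> [/nbhs_normP[e /= /Cplx_gt0P[e0 ee] eP]|[e e0 eP]].
  exists (complex.Re e) => // w wz; apply: eP => /=.
  by rewrite ee normE ltcR ncB.
apply/nbhs_normP; exists (e%:C)%C; first by rewrite /= ltcR.
by move=> w; rewrite /= normE ltcR ncB; exact: eP.
Qed.

Lemma nc_continuous (R : realType) : continuous (fun z : Cplx R => nc z).
Proof.
move=> z; apply/(@cvgrPdist_lt _ _ _ (nbhs z) (nbhs_filter z)) => e e0.
apply/nbhsCP; exists e => // w wz.
rewrite ltr_norml; have := nc_le_add_dist z w; have := nc_le_add_dist w z.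
rewrite (ncB z w); lra.
Qed.

Lemma cvgC_nc_le (R : realType) (u : nat -> Cplx R) (l : Cplx R) (M : R) :
  u @ \oo --> l -> (forall n, nc (u n) <= M) -> nc l <= M.
Proof.
move=> /cvgnCP ul uM; apply/ler_addgt0Pr => e /ul[N /(_ N (leqnn N)) lu].
by rewrite (le_trans (nc_le_add_dist l (u N)))// lerD// ltW.
Qed.

(** The square [-r, r]^2 is compact, and the disc is a closed part of its
    image. *)
Lemma compact_disc (R : realType) (r : R) :
  compact [set z : Cplx R | nc z <= r].
Proof.
pose K := [set p : R * R | `[- r, r]%classic p.1 /\ `[- r, r]%classic p.2].
pose h (p : R * R) : Cplx R := Complex p.1 p.2.
have cK : compact K by apply: compact_setX; exact: segment_compact.
have hc : continuous h.
  move=> [a b]; apply/cvgC_nbhs => e e0.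
  have e20 : 0 < e / 2 by lra.
  exists (ball a (e / 2), ball b (e / 2)).
    by split; exact: nbhsx_ballx.
  move=> p [pa pb]; rewrite /ball /= in pa pb.
  have -> : h (a, b) - h p = ((a - p.1)%:C)%C + 'i%C * ((b - p.2)%:C)%C :> Cplx R.
    by rewrite /h; simpc.
  rewrite (le_lt_trans (ncD _ _))// ncM !nc_real.
  have -> : nc ('i%C : Cplx R) = 1 by rewrite /= expr0n expr1n add0r sqrtr1.
  by rewrite mul1r; lra.
have cI : compact (h @` K).
  by apply: continuous_compact => //; exact: continuous_subspaceT.
apply: (subclosed_compact _ cI).
  rewrite (_ : [set z | _] = (fun z : Cplx R => nc z) @^-1` [set x | x <= r])//.
  by apply: closed_comp; [move=> z _; exact: nc_continuous|exact: closed_le].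
move=> z /= zr; exists (complex.Re z, complex.Im z); last by case: z {zr}.
have r0 : 0 <= r by exact: le_trans (nc_ge0 _) zr.
case: z zr => a b /= abr; rewrite /K /= !in_itv /= -!ler_norml.
have ab : a ^+ 2 + b ^+ 2 <= r ^+ 2.
  rewrite -(ler_pXn2r (n:=2)) ?nnegrE ?sqrtr_ge0// sqr_sqrtr// in abr.
  by rewrite addr_ge0 ?sqr_ge0.
split; rewrite -(ler_pXn2r (n:=2)) ?nnegrE// real_normK ?num_real//;
  have := sqr_ge0 a; have := sqr_ge0 b; lra.
Qed.

(** * Power series and the mean square inequality *)

Definition psum (R : realType) (c : nat -> Cplx R) (N : nat) (w : Cplx R) :
  Cplx R := \sum_(n < N) c n * w ^+ n.

Definition sums_on (R : realType) (r : R) (c : nat -> Cplx R)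
    (F : Cplx R -> Cplx R) : Prop :=
  forall w, nc w < r -> psum c N w @[N --> \oo] --> F w.

Lemma psumS (R : realType) (c : nat -> Cplx R) N w :
  psum c N.+1 w = psum c N w + c N * w ^+ N.
Proof. by rewrite /psum big_ord_recr. Qed.

Lemma sum_geom_le (R : realType) (q : R) N :
  0 <= q < 1 -> \sum_(n < N) q ^+ n <= (1 - q)^-1.
Proof.
move=> /andP[q0 q1]; have q10 : 0 < 1 - q by lra.
rewrite -(ler_pM2l q10) mulfV ?gt_eqF//.
rewrite -[1 - q]opprB mulNr -subrX1 opprB lerBlDr lerDl exprn_ge0//.
Qed.

Lemma geom_small (R : realType) (q A e : R) : 0 <= q < 1 -> 0 < e ->
  exists N0, forall N, (N0 <= N)%N -> A * q ^+ N < e.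
Proof.
move=> /andP[q0 q1] e0.
have : geometric A q @ \oo --> 0 by apply: cvg_geometric; rewrite ger0_norm.
move=> /cvgrPdist_lt/(_ _ e0)[N0 _ NP]; exists N0 => N /NP /=.
by rewrite sub0r normrN; apply: le_lt_trans; rewrite ler_norm.
Qed.

(** The terms are bounded at a radius x strictly between t and r, so at t they
    are dominated by a geometric series of ratio t / x. *)
Lemma psum_abs_bounded (R : realType) (r t : R) (c : nat -> Cplx R) (F : Cplx R -> Cplx R) :
  sums_on r c F -> 0 <= t < r ->
  exists A, forall N, \sum_(n < N) nc (c n) * t ^+ n <= A.
Proof.
move=> cF /andP[t0 tr]; pose x := (t + r) / 2.
have xt : t < x by rewrite /x; lra.
have xr : x < r by rewrite /x; lra.
have x0 : 0 < x by lra.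
have ncx : nc ((x%:C)%C : Cplx R) = x by rewrite nc_real gtr0_norm.
have /cF /cvgnCP /(_ 1 ltr01)[N0 N0P] : nc ((x%:C)%C : Cplx R) < r by rewrite ncx.
pose B := \sum_(n < N0) nc (c n) * x ^+ n + 2.
have pos n : 0 <= nc (c n) * x ^+ n by rewrite mulr_ge0 ?nc_ge0 ?exprn_ge0// ltW.
have sB : 2 <= B by rewrite /B lerDr sumr_ge0.
have cB n : nc (c n) * x ^+ n <= B.
  have [nN|Nn] := ltnP n N0.
    by rewrite /B (bigD1 (Ordinal nN))//= -addrA lerDl addr_ge0// sumr_ge0.
  rewrite (le_trans _ sB)//.
  have -> : nc (c n) * x ^+ n = nc (psum c n.+1 (x%:C)%C - psum c n (x%:C)%C).
    by rewrite psumS addrAC subrr add0r ncM ncX ncx.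
  rewrite (le_trans (nc_dist (F (x%:C)%C) _ _))//.
  have := N0P n Nn; have := N0P n.+1 (leqW Nn); rewrite (ncB _ (F _)); lra.
have q01 : 0 <= t / x < 1.
  by rewrite divr_ge0 ?(ltW x0)//= ltr_pdivrMr// mul1r.
exists (B / (1 - t / x)) => N.
have B0 : 0 <= B by lra.
rewrite (le_trans _ (ler_wpM2l B0 (sum_geom_le N q01)))// mulr_sumr ler_sum// => n _.
rewrite -[t in leLHS](mulfVK (lt0r_neq0 x0)) exprMn mulrCA mulrC.
by rewrite ler_wpM2r// exprn_ge0//; case/andP: q01.
Qed.

(** The n-th term at w is (|w|/t)^n times a term of the absolutely convergent
    series at t. Multiplying out t^N keeps the case t = 0. For N = 1 this is
    the continuity of the sum at the centre. *)
Lemma psum_tail (R : realType) (t A : R) (c : nat -> Cplx R) (w l : Cplx R) (N : nat) :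
  (forall N, \sum_(n < N) nc (c n) * t ^+ n <= A) ->
  nc w <= t -> psum c N w @[N --> \oo] --> l ->
  t ^+ N * nc (l - psum c N w) <= nc w ^+ N * A.
Proof.
move=> cA wt cl; have t0 : 0 <= t := le_trans (nc_ge0 w) wt.
have A0 : 0 <= A by have := cA 0%N; rewrite big_ord0.
have fin k : t ^+ N * nc (psum c (N + k) w - psum c N w) <= nc w ^+ N * A.
  rewrite /psum big_split_ord /= addrAC subrr add0r.
  rewrite (le_trans (ler_wpM2l _ (nc_sum _ _ _)))// ?exprn_ge0//.
  rewrite (le_trans _ (ler_wpM2l _ (cA (N + k)%N))) ?exprn_ge0 ?nc_ge0//.
  rewrite big_split_ord /= mulrDr -[leLHS]add0r lerD//.
    by rewrite mulr_ge0 ?sumr_ge0 ?exprn_ge0 ?nc_ge0// => i _; rewrite mulr_ge0 ?exprn_ge0 ?nc_ge0.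
  rewrite !mulr_sumr ler_sum// => i _.
  rewrite ncM ncX !exprD; set p := nc _; set x := t ^+ N; set y := nc w ^+ N.
  have -> : x * (p * (y * nc w ^+ i)) = p * x * y * nc w ^+ i by ring.
  have -> : y * (p * (x * t ^+ i)) = p * x * y * t ^+ i by ring.
  rewrite ler_wpM2l ?lerXn2r ?nnegrE ?nc_ge0//.
  by rewrite !mulr_ge0 ?nc_ge0 ?exprn_ge0 ?nc_ge0.
apply/ler_addgt0Pr => e e0.
have e'0 : 0 < e / (t ^+ N + 1) by rewrite divr_gt0// ltr_wpDl// exprn_ge0.
have /cvgnCP/(_ _ e'0)[m /(_ (N + m)%N (leq_addl _ _)) lm] := cl.
rewrite (le_trans (ler_wpM2l _ (nc_dist (psum c (N + m) w) _ _)))// ?exprn_ge0//.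
rewrite mulrDr addrC lerD// (le_trans (ler_wpM2l _ (ltW lm)))// ?exprn_ge0//.
rewrite mulrA ler_pdivrMr; last by rewrite ltr_wpDl// exprn_ge0.
by rewrite mulrC ler_wpM2l ?(ltW e0)// lerDl.
Qed.

(** Only values on the circle of radius s are used. On that circle the partial
    sum of length n differs from F by at most A (s/t)^n, so the exact identity
    over the n-th roots of unity holds for F up to an error tending to 0. *)
Lemma bessel (R : realType) (r s M : R) (c : nat -> Cplx R) (F : Cplx R -> Cplx R) N :
  sums_on r c F -> 0 < s < r -> (forall w, nc w = s -> nc (F w) <= M) ->
  \sum_(n < N) (nc (c n) * s ^+ n) ^+ 2 <= M ^+ 2.
Proof.
move=> cF /andP[s0 sr] FM; pose t := (s + r) / 2.
have st : s < t by rewrite /t; lra.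
have tr : t < r by rewrite /t; lra.
have t0 : 0 < t by lra.
have ncs : nc ((s%:C)%C : Cplx R) = s by rewrite nc_real gtr0_norm.
have M0 : 0 <= M by rewrite (le_trans (nc_ge0 _) (FM _ ncs)).
have [|A cA] := psum_abs_bounded cF (t := t); first by rewrite (ltW t0).
have A0 : 0 <= A by have := cA 0%N; rewrite big_ord0.
have q01 : 0 <= s / t < 1.
  by rewrite divr_ge0 ?ltW//= ltr_pdivrMr// mul1r.
have near_circle w n : nc w = s -> nc (psum c n w) <= M + A * (s / t) ^+ n.
  move=> ws; rewrite (le_trans (nc_le_add_dist _ (F w)))// lerD ?FM// ncB.
  have wt : nc w <= t by rewrite ws ltW.
  have /(psum_tail n cA wt) : psum c N w @[N --> \oo] --> F w by apply: cF; rewrite ws.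
  rewrite ws -ler_pdivlMl ?exprn_gt0//.
  suff -> : A * (s / t) ^+ n = (t ^+ n)^-1 * (s ^+ n * A) by [].
  by rewrite expr_div_n; ring.
have avg n : (0 < n)%N ->
    \sum_(i < n) (nc (c i) * s ^+ i) ^+ 2 <= (M + A * (s / t) ^+ n) ^+ 2.
  move=> n0; have [z zn] := prim_root_exists (Cplx R) n0.
  have nz : nc z = 1.
    by apply/eqP; rewrite -(@pexpr_eq1 _ _ n) ?nc_ge0// -ncX (prim_expr_order zn) nc1.
  have := parseval_prim_root (fun i => c i * (s%:C)%C ^+ i) zn.
  have E1 : \sum_(j < n) `|\sum_(i < n) c i * (s%:C)%C ^+ i * (z ^+ j) ^+ i| ^+ 2
      = ((\sum_(j < n) nc (psum c n ((s%:C)%C * z ^+ j)) ^+ 2)%:C)%C.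
    rewrite rmorph_sum; apply: eq_bigr => j _; rewrite normE rmorphXn.
    congr ((nc _)%:C%C ^+ 2); apply: eq_bigr => i _.
    by rewrite exprMn mulrA.
  have E2 : n%:R * \sum_(i < n) `|c i * (s%:C)%C ^+ i| ^+ 2
      = ((n%:R * \sum_(i < n) (nc (c i) * s ^+ i) ^+ 2)%:C)%C.
    rewrite rmorphM rmorph_nat rmorph_sum; congr (_ * _); apply: eq_bigr => j _.
    by rewrite normE rmorphXn ncM ncX ncs.
  rewrite E1 E2 => /complexI E.
  have n0' : 0 < n%:R :> R by rewrite ltr0n.
  rewrite -(ler_pM2l n0') -E -[n%:R]mulr_natl mulr1 mulr_natl.
  rewrite -[n in _ *+ n]card_ord -sumr_const ler_sum// => j _.
  rewrite lerXn2r ?nnegrE ?nc_ge0//.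
    by rewrite addr_ge0// mulr_ge0// exprn_ge0//; case/andP: q01.
  by apply: near_circle; rewrite ncM ncX nz expr1n mulr1.
apply/ler_addgt0Pr => e e0.
have d0 : 0 < Num.min 1 (e / (2 * M + 1)).
  by rewrite lt_min ltr01 divr_gt0//; lra.
have [N0 N0P] := geom_small A q01 d0.
pose n := (maxn N0 N).+1.
have nN : (N <= n)%N by rewrite /n leqW// leq_maxr.
have := avg n isT; have := N0P n; rewrite /n leqW ?leq_maxl// -/n => /(_ isT).
rewrite lt_min => /andP[d1 d2] Sn.
set d := A * _ in d1 d2 Sn.
have dge : 0 <= d by rewrite mulr_ge0// exprn_ge0//; case/andP: q01.
rewrite (@le_trans _ _ (\sum_(i < n) (nc (c i) * s ^+ i) ^+ 2))//.
  rewrite -(subnK nN) addnC big_split_ord /= lerDl sumr_ge0// => i _.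
  by rewrite sqr_ge0.
rewrite (le_trans Sn)//.
have : d * (2 * M + 1) <= e by rewrite -ler_pdivlMr ?ltW//; lra.
nra.
Qed.

(** * Termwise differentiation of power series *)

Definition dcoef (R : realType) (c : nat -> Cplx R) (n : nat) : Cplx R :=
  n.+1%:R * c n.+1.

(** Together with taylor_pow_le, this bounds the derivative and the second order
    remainder of w^n on the disc of radius s by t^n, up to powers of t - s.
    Absolute convergence at t then controls the differentiated series. *)
Lemma nat_pow_le (R : realType) (s t : R) (n : nat) :
  0 <= s <= t -> n%:R * s ^+ n.-1 * (t - s) <= t ^+ n.
Proof.
move=> /andP[s0 st]; have ts : 0 <= t - s by lra.
elim: n => [|n IH]; first by rewrite !mul0r.
have -> : n.+1%:R * s ^+ n = s * (n%:R * s ^+ n.-1) + s ^+ n.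
  case: n {IH} => [|n]; first by rewrite mul0r mulr0 add0r mul1r.
  by rewrite /= mulrCA -exprS -[n.+2%:R]natr1 mulrDl mul1r.
rewrite mulrDl -mulrA exprS -[X in X * t ^+ n](subrKC s t) mulrDl lerD ?ler_wpM2l//.
by rewrite mulrC ler_wpM2l// lerXn2r// nnegrE (le_trans s0).
Qed.

(** The remainder R_n = u^n - w^n - n (u - w) w^(n-1) satisfies
    R_(n+1) = u R_n + n (u - w)^2 w^(n-1). *)
Lemma taylor_pow_le (R : realType) (u w : Cplx R) (s t : R) (n : nat) :
  nc u <= s -> nc w <= s -> s <= t ->
  nc (u ^+ n - w ^+ n - (u - w) * (n%:R * w ^+ n.-1)) * (t - s) ^+ 2
    <= nc (u - w) ^+ 2 * t ^+ n.
Proof.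
move=> us ws st; have s0 := le_trans (nc_ge0 u) us.
have ts : 0 <= t - s by lra.
elim: n => [|n IH].
  by rewrite !expr0 subrr mul0r mulr0 subrr nc0 mul0r mulr1 sqr_ge0.
have -> : u ^+ n.+1 - w ^+ n.+1 - (u - w) * (n.+1%:R * w ^+ n) =
   u * (u ^+ n - w ^+ n - (u - w) * (n%:R * w ^+ n.-1))
   + (u - w) ^+ 2 * (n%:R * w ^+ n.-1).
  case: n {IH} => [|n]; first by rewrite !expr0 mul0r mulr0 subrr mulr0 subr0; ring.
  by rewrite /= -!natr1 !exprS; ring.
rewrite (le_trans (ler_wpM2r (sqr_ge0 _) (ncD _ _)))// mulrDl (exprS t).
have -> : nc (u - w) ^+ 2 * (t * t ^+ n) = 
  s * (nc (u - w) ^+ 2 * t ^+ n) + nc (u - w) ^+ 2 * (t ^+ n * (t - s)) by ring.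
rewrite lerD//.
  by rewrite ncM -mulrA ler_pM// ?nc_ge0// mulr_ge0 ?nc_ge0 ?sqr_ge0.
rewrite ncM ncX [nc (n%:R * _)]ncM nc_nat ncX -mulrA ler_wpM2l ?sqr_ge0//.
rewrite [(t - s) ^+ 2]expr2 mulrA ler_wpM2r//.
rewrite (le_trans _ (nat_pow_le n (s := nc w) _))//; last first.
  by rewrite nc_ge0 (le_trans ws).
by rewrite ler_wpM2l ?lerB// mulr_ge0 ?exprn_ge0 ?nc_ge0.
Qed.

Lemma psum_dcoef (R : realType) (c : nat -> Cplx R) (N : nat) (w : Cplx R) :
  psum (dcoef c) N w = \sum_(n < N.+1) c n * (n%:R * w ^+ n.-1).
Proof.
rewrite big_ord_recl mul0r mulr0 add0r; apply: eq_bigr => n _.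
by rewrite /dcoef mulrAC mulrC.
Qed.

(** Real and imaginary parts reduce the statement to the completeness of the
    reals. *)
Lemma abs_cvg_Cplx (R : realType) (a : nat -> Cplx R) (A : R) :
  (forall N, \sum_(n < N) nc (a n) <= A) ->
  exists l : Cplx R, \sum_(n < N) a n @[N --> \oo] --> l.
Proof.
move=> aA.
have real_cvg (b : nat -> R) : (forall n, `|b n| <= nc (a n)) ->
    exists l : R, \sum_(n < N) b n @[N --> \oo] --> l.
  move=> ba; have : cvgn (series b).
    apply: normed_cvg; apply: nondecreasing_is_cvgn.
      by apply: nondecreasing_series => n _ _; exact: normr_ge0.
    exists A => _ [N _ <-]; rewrite /normed_series_of /series /= big_mkord (le_trans _ (aA N))//.
    by rewrite ler_sum.
  move=> /cvg_ex[l bl]; exists l.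
  rewrite (_ : (fun N => \sum_(n < N) b n) = series b)//.
  by apply/funext => N; rewrite /series /= big_mkord.
have [x /cvgrPdist_lt ax] : exists l : R, \sum_(n < N) complex.Re (a n) @[N --> \oo] --> l.
  by apply: (real_cvg (fun n => complex.Re (a n))) => n;
     have := normc_ge_Re (a n); rewrite lecE normE => /andP[].
have [y /cvgrPdist_lt ay] : exists l : R, \sum_(n < N) complex.Im (a n) @[N --> \oo] --> l.
  apply: (real_cvg (fun n => complex.Im (a n))) => n; case: (a n) => u v /=.
  rewrite -sqrtr_sqr ler_wsqrtr// lerDr sqr_ge0//.
exists (Complex x y : Cplx R); apply/cvgnCP => e e0.
have e2 : 0 < e / 2 by lra.
have [N1 _ N1P] := ax _ e2; have [N2 _ N2P] := ay _ e2.
exists (maxn N1 N2) => n; rewrite geq_max => /andP[/N1P Hx /N2P Hy] /=.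
have -> : Complex x y - \sum_(i < n) a i =
   ((x - \sum_(i < n) complex.Re (a i))%:C)%C
   + 'i%C * ((y - \sum_(i < n) complex.Im (a i))%:C)%C :> Cplx R.
  rewrite (_ : \sum_(i < n) a i = Complex (\sum_(i < n) complex.Re (a i))
                           (\sum_(i < n) complex.Im (a i))); first by simpc.
  elim/big_rec3: _ => // i p q z _ ->; by case: (a i).
rewrite (le_lt_trans (ncD _ _))// ncM !nc_real.
have -> : nc ('i%C : Cplx R) = 1 by rewrite /= expr0n expr1n add0r sqrtr1.
by rewrite mul1r; move: Hx Hy => /=; lra.
Qed.

(** The Taylor remainders of the partial sums are bounded by
    |u - w|^2 A / (t - s)^2 uniformly in N, hence so is that of F. *)
Lemma sums_on_derive1 (R : realType) (r : R) (c : nat -> Cplx R)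
    (F : Cplx R -> Cplx R) :
  sums_on r c F -> sums_on r (dcoef c) (derive1 F).
Proof.
move=> cF w wr; pose s := (nc w + r) / 2; pose t := (s + r) / 2.
have w0 := nc_ge0 w.
have ws : nc w < s by rewrite /s; lra.
have st : s < t by rewrite /t /s; lra.
have tr : t < r by rewrite /t /s; lra.
have ts0 : 0 < (t - s) ^+ 2 by rewrite exprn_gt0//; lra.
have [|A cA] := psum_abs_bounded cF (t := t); first by rewrite tr andbT; lra.
have A0 : 0 <= A by have := cA 0%N; rewrite big_ord0.
have [l dl] : exists l : Cplx R, psum (dcoef c) N w @[N --> \oo] --> l.
  apply: (@abs_cvg_Cplx R (fun n => dcoef c n * w ^+ n) (A / (t - s))) => N.
  rewrite ler_pdivlMr; last by lra.
  rewrite (le_trans _ (cA N.+1))// big_ord_recl mulr_suml -[leLHS]add0r lerD//.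
    by rewrite mulr_ge0 ?nc_ge0.
  apply: ler_sum => n _ /=; rewrite /dcoef !ncM nc_nat ncX.
  rewrite /bump /= add1n [_.+1%:R * _]mulrC -!mulrA ler_wpM2l ?nc_ge0// mulrA.
  rewrite (le_trans _ (nat_pow_le n.+1 (s := nc w) _))//; last by rewrite w0; lra.
  by rewrite ler_wpM2l ?mulr_ge0 ?exprn_ge0// lerB// ltW.
have quad u : nc u <= s ->
    nc (F u - F w - (u - w) * l) <= nc (u - w) ^+ 2 * A / (t - s) ^+ 2.
  move=> us.
  apply: (@cvgC_nc_le _ (fun N => psum c N.+1 u - psum c N.+1 w
                                  - (u - w) * psum (dcoef c) N w)).
    have cFS v : nc v < r -> psum c N.+1 v @[N --> \oo] --> F v.
      by move=> vr; have := cF v vr; rewrite -(cvg_shiftS (fun N => psum c N v)).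
    apply: cvgB; last by apply: cvgM; [exact: cvg_cst|].
    by apply: cvgB; apply: cFS; lra.
  move=> N; rewrite ler_pdivlMr// psum_dcoef /psum -sumrB mulr_sumr -sumrB.
  rewrite (le_trans (ler_wpM2r (ltW ts0) (nc_sum _ _ _)))//.
  rewrite (le_trans _ (ler_wpM2l (sqr_ge0 _) (cA N.+1)))//.
  rewrite mulr_suml mulr_sumr ler_sum// => n _.
  have -> : c n * u ^+ n - c n * w ^+ n - (u - w) * (c n * (n%:R * w ^+ n.-1))
      = c n * (u ^+ n - w ^+ n - (u - w) * (n%:R * w ^+ n.-1)) by ring.
  rewrite ncM -mulrA [leRHS]mulrCA ler_wpM2l ?nc_ge0//.
  by apply: taylor_pow_le => //; lra.
suff -> : derive1 F w = l by [].
apply: cvg_lim; first exact: norm_hausdorff.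
apply/cvgC_nbhs => e e0.
have d0 : 0 < Num.min (s - nc w) (e * (t - s) ^+ 2 / (A + 1)).
  by rewrite lt_min subr_gt0 ws divr_gt0 ?mulr_gt0//; lra.
apply/nbhsCP; exists (Num.min (s - nc w) (e * (t - s) ^+ 2 / (A + 1))) => // h.
rewrite subr0 lt_min => /andP[hs he] h0.
have hn0 : 0 < nc h by rewrite nc_gt0.
have hws : nc (h + w) <= s by rewrite (le_trans (ncD _ _))//; lra.
have := quad _ hws; rewrite addrK => q.
rewrite -(ltr_pM2l hn0) -ncM.
have -> : h * (l - h^-1 *: (F (h + w) - F w)) = - (F (h + w) - F w - h * l).
  by rewrite opprB mulrBr; congr (_ - _); rewrite -[h^-1 *: _]/(h^-1 * _) mulVKf.
rewrite ncN (le_lt_trans q)//.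
rewrite ltr_pdivrMr// expr2 -!mulrA ltr_pM2l//.
rewrite ltr_pdivlMr in he; last by lra.
rewrite (le_lt_trans _ he)// ler_wpM2l ?nc_ge0//; lra.
Qed.

Lemma sums_on_derive1n (R : realType) (r : R) (c : nat -> Cplx R)
    (F : Cplx R -> Cplx R) (j : nat) :
  sums_on r c F -> sums_on r (iter j (@dcoef R) c) (derive1n j F).
Proof.
move=> cF; elim: j => [|j IH]; first exact: cF.
by rewrite derive1nS iterS; exact: sums_on_derive1 IH.
Qed.

Lemma iter_dcoefE (R : realType) (c : nat -> Cplx R) (j n : nat) :
  iter j (@dcoef R) c n = ((n + j) ^_ j)%:R * c (n + j)%N.
Proof.
elim: j n => [|j IH] n; first by rewrite addn0 ffactn0 mul1r.
rewrite /= /dcoef IH addSn addnS mulrA -natrM; congr (_%:R * _).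
by rewrite ffactnSr -addSn addnK mulnC.
Qed.

Lemma sums_on0 (R : realType) (r : R) (c : nat -> Cplx R)
    (F : Cplx R -> Cplx R) : 0 < r -> sums_on r c F -> F 0 = c 0%N.
Proof.
move=> r0 /(_ 0); rewrite nc0 => /(_ r0) cF.
have := cF; rewrite -(cvg_shiftS (fun N => psum c N 0)) => cF'.
apply: (cvg_unique (@norm_hausdorff _ _) cF').
rewrite (_ : (fun N => psum c N.+1 0) = fun=> c 0%N); first exact: cvg_cst.
apply/funext => N; rewrite /psum big_ord_recl expr0 mulr1 big1 ?addr0// => i _.
by rewrite expr0n /= mulr0.
Qed.

Lemma derive1n_at0 (R : realType) (r : R) (c : nat -> Cplx R)
    (F : Cplx R -> Cplx R) (j : nat) :
  0 < r -> sums_on r c F -> derive1n j F 0 = j`!%:R * c j.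
Proof.
move=> r0 cF; rewrite (sums_on0 r0 (sums_on_derive1n (j:=j) cF)) iter_dcoefE.
by rewrite add0n ffactnn.
Qed.

(** * The maximum principle and the Schwarz lemma *)

(** Expansion around z, recentred at 0 so that the results on power series
    apply directly. *)
Definition analytic_at (R : realType) (g : Cplx R -> Cplx R) (z : Cplx R) :
  Prop := exists r c, 0 < r /\ sums_on r c (fun x => g (x + z)).

Lemma analytic_onP (R : realType) (U : set (Cplx R)) (g : Cplx R -> Cplx R)
  (z : Cplx R) : analytic_on U g -> U z -> analytic_at g z.
Proof.
move=> gU /gU[c /nbhsCP[r r0 gc]]; exists r, c; split=> // x xr.
by have := gc (x + z); rewrite addrK => /(_ xr).
Qed.

Lemma analytic_at_continuous (R : realType) (g : Cplx R -> Cplx R)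
  (z : Cplx R) : analytic_at g z -> {for z, continuous g}.
Proof.
move=> [r [c [r0 gc]]]; pose t := r / 2.
have t0 : 0 < t by rewrite /t; lra.
have tr : t < r by rewrite /t; lra.
have [|A cA] := psum_abs_bounded gc (t := t); first by rewrite (ltW t0).
have A0 : 0 <= A by have := cA 0%N; rewrite big_ord0.
have gz : g z = c 0%N by rewrite -(sums_on0 r0 gc) add0r.
apply/(@cvgC_nbhs _ _ (nbhs z) (nbhs_filter z)) => e e0; apply/nbhsCP.
have d0 : 0 < Num.min t (e * t / (A + 1)).
  by rewrite lt_min t0 divr_gt0 ?mulr_gt0//; lra.
exists (Num.min t (e * t / (A + 1))) => // w; rewrite lt_min => /andP[wt we].
have := psum_tail 1 cA (ltW wt) (gc _ (lt_trans wt tr)).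
rewrite !expr1 subrK /psum big_ord1 expr0 mulr1 -gz ncB => tail.
rewrite -(ltr_pM2l t0) (le_lt_trans tail)// [ltRHS]mulrC.
rewrite ltr_pdivlMr in we; last by lra.
rewrite (le_lt_trans _ we)// ler_wpM2l ?nc_ge0//; lra.
Qed.

(** Among the points where |G| is maximal over the disc, choose one, q, with
    largest real part. If q were interior, the mean square inequality on a
    small circle would make G constant near q, so q + s would be a maximum
    with larger real part. *)
Lemma max_modulus (R : realType) (G : Cplx R -> Cplx R) (rho M : R) :
  0 <= rho ->
  (forall z, nc z <= rho -> analytic_at G z) ->
  (forall z, nc z = rho -> nc (G z) <= M) ->
  forall z, nc z <= rho -> nc (G z) <= M.
Proof.
move=> rho0 aG GM; pose K := [set z : Cplx R | nc z <= rho].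
have cK : compact K := @compact_disc R rho.
have K0 : K !=set0 by exists 0; change (nc (0 : Cplx R) <= rho); rewrite nc0.
pose f z := nc (G z).
have cf z : K z -> {for z, continuous f}.
  move=> Kz; apply: (@continuous_comp _ _ _ G (fun x : Cplx R => nc x)).
    by apply: analytic_at_continuous; exact: aG.
  exact: nc_continuous.
have wf : {within K, continuous f}.
  by apply: continuous_in_subspaceT => z /set_mem; exact: cf.
have [p /set_mem Kp pmax] := compact_EVT_max K0 cK wf.
suff pM : f p <= M by move=> z zr; rewrite (le_trans (pmax z _))//; exact/mem_set.
pose K' := K `&` [set z | f p <= f z].
have cK' : compact K'.
  apply: (subclosed_compact _ cK); last by move=> z [].
  move=> z clz; have Kz : K z.
    apply: (compact_closed (@norm_hausdorff _ _) cK) => B /clz[y [[Ky _] By]].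
    by exists y.
  split=> //=; rewrite leNgt; apply/negP => fz.
  have /clz[y [[_ /= fy]]] : nbhs z [set y | f y < f p].
    exact: (cvgr_lt (f z) (cf z Kz) _ fz).
  by rewrite ltNge fy.
have cRe : continuous (fun z : Cplx R => complex.Re z).
  move=> z; apply/(@cvgrPdist_lt _ _ _ (nbhs z) (nbhs_filter z)) => e e0.
  apply/nbhsCP; exists e => // w; apply: le_lt_trans.
  rewrite ncB -lecR -normE (le_trans _ (normc_ge_Re _))//.
  by rewrite lecR; case: z; case: w.
have K'0 : K' !=set0 by exists p; split => //=; exact: lexx.
have [q /set_mem[Kq fq] qmax] :=
    compact_EVT_max K'0 cK' (continuous_subspaceT cRe).
have [qr|qr] := ltP (nc q) rho; last first.
  by rewrite (le_trans fq)// GM//; apply/eqP; rewrite eq_le qr andbT.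
have [r [c [r0 Gc]]] := aG q Kq.
have Gq : G q = c 0%N by rewrite -(sums_on0 r0 Gc) add0r.
pose s := Num.min r (rho - nc q) / 2.
have s0 : 0 < Num.min r (rho - nc q) by rewrite lt_min r0 subr_gt0.
have /andP[sr sq] : (s < r) && (s < rho - nc q).
  by rewrite -lt_min /s; lra.
have {}s0 : 0 < s by rewrite /s; lra.
have inK x : nc x = s -> K (x + q).
  by move=> xs; rewrite /K /= (le_trans (ncD _ _))// xs; lra.
have c0 n : c n.+1 = 0.
  have := bessel n.+2 Gc (s := s) (M := nc (c 0%N)); rewrite s0 sr => /(_ isT).
  have on_circle w : nc w = s -> nc (G (w + q)) <= nc (c 0%N).
    move=> ws; rewrite -Gq (le_trans (pmax _ (mem_set (inK _ ws))))//.
  move=> /(_ on_circle); rewrite big_ord_recl expr0 mulr1 -lerBrDl subrr.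
  rewrite big_ord_recr /= => /le_gtF.
  rewrite /bump /= add1n => H; apply/eqP; move: H; apply: contraFT => cn.
  rewrite ltr_wpDl ?sumr_ge0// => [i _|]; first exact: sqr_ge0.
  by rewrite exprn_gt0// mulr_gt0 ?nc_gt0// exprn_gt0.
have ncs : nc ((s%:C)%C : Cplx R) = s by rewrite nc_real gtr0_norm.
have Gs : G ((s%:C)%C + q) = c 0%N.
  have := Gc (s%:C)%C; rewrite ncs => /(_ sr); rewrite -(cvg_shiftS (fun N => psum c N _)).
  move=> H; apply: (cvg_unique (@norm_hausdorff _ _) H).
  rewrite (_ : (fun N => psum c N.+1 _) = fun=> c 0%N); first exact: cvg_cst.
  apply/funext => N; rewrite /psum big_ord_recl expr0 mulr1 big1 ?addr0// => i _.
  by rewrite c0 mul0r.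
have /mem_set/qmax : K' ((s%:C)%C + q).
  by split; [exact: inK|rewrite /= {2}/f Gs -Gq].
by rewrite leNgt; case: (q) => a b /=; rewrite ltrDr s0.
Qed.

(** The Taylor coefficients e_n of g(x + z) / (x + z) at x = 0, determined by
    z e_n + e_(n-1) = c_n. *)
Fixpoint quot_coef (R : realType) (c : nat -> Cplx R) (z : Cplx R) (n : nat) :
  Cplx R :=
  if n is m.+1 then (c n - quot_coef c z m) / z else c 0%N / z.

(** Multiplying the partial sums of the quotient back by x + z telescopes, so
    convergence only requires the last term to vanish in the limit. *)
Lemma psum_quot (R : realType) (c : nat -> Cplx R) (z x : Cplx R) (N : nat) :
  z != 0 ->
  psum (quot_coef c z) N.+1 x * (x + z)
    = psum c N.+1 x + quot_coef c z N * x ^+ N.+1.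
Proof.
move=> z0; elim: N => [|N IH].
  by rewrite /psum !big_ord1 !expr0 !mulr1 expr1 mulrDr divfK// addrC.
rewrite psumS mulrDl IH [in RHS]psumS /= [x ^+ N.+2]exprSr.
set y := x ^+ N.+1; set e := quot_coef c z N; field.
exact: z0.
Qed.

(** The bound is the fixed point K of the recursion, A + t K = |z| K. *)
Lemma quot_coef_bound (R : realType) (c : nat -> Cplx R) (z : Cplx R)
    (t A : R) (n : nat) :
  0 <= t < nc z -> (forall n, nc (c n) * t ^+ n <= A) ->
  nc (quot_coef c z n) * t ^+ n <= A / (nc z - t).
Proof.
move=> /andP[t0 tz] cA; have zt : 0 < nc z - t by lra.
have A0 : 0 <= A by rewrite (le_trans _ (cA 0%N))// mulr1 nc_ge0.
have z0 : 0 < nc z by lra.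
have rec : A + t * (A / (nc z - t)) = nc z * (A / (nc z - t)) by field; lra.
have AK : 0 <= A / (nc z - t) by rewrite divr_ge0// ltW.
elim: n => [|n IH] /=; rewrite ncM ncV mulrAC ler_pdivrMr// mulrC [leRHS]mulrC -rec.
  by rewrite mulrC (le_trans (cA 0%N))// lerDl mulr_ge0.
rewrite mulrC (le_trans (ler_wpM2r _ (ncD _ _))) ?exprn_ge0// ncN mulrDl lerD//.
by rewrite exprS mulrCA ler_wpM2l.
Qed.

Lemma analytic_at_quot (R : realType) (g : Cplx R -> Cplx R) (z a : Cplx R) :
  z != 0 -> analytic_at g z ->
  analytic_at (fun w => if w == 0 then a else g w / w) z.
Proof.
move=> z0 [r [c [r0 gc]]]; have zn0 : 0 < nc z by rewrite nc_gt0.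
pose t := Num.min r (nc z) / 2.
have m0 : 0 < Num.min r (nc z) by rewrite lt_min r0.
have /andP[tr tz] : (t < r) && (t < nc z) by rewrite -lt_min /t; lra.
have t0 : 0 < t by rewrite /t; lra.
have [|A cA] := psum_abs_bounded gc (t := t); first by rewrite (ltW t0).
have cnA n : nc (c n) * t ^+ n <= A.
  rewrite (le_trans _ (cA n.+1))// big_ord_recr lerDr sumr_ge0// => i _.
  by rewrite mulr_ge0 ?nc_ge0// exprn_ge0// ltW.
exists t, (quot_coef c z); split=> // x xt.
have xz0 : x + z != 0.
  apply: contraTneq xt => /eqP; rewrite addr_eq0 => /eqP ->.
  by rewrite ncN -leNgt ltW.
rewrite (negbTE xz0) -(cvg_shiftS (fun N => psum _ N _)).
rewrite (_ : (fun N => _) = fun N =>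
    (psum c N.+1 x + quot_coef c z N * x ^+ N.+1) / (x + z)); last first.
  by apply/funext => N; rewrite -psum_quot// mulfK.
apply: cvgM; last exact: cvg_cst.
rewrite -[X in _ --> X]addr0; apply: cvgD.
  by rewrite (cvg_shiftS (fun N => psum c N x)); apply: gc; exact: lt_trans tr.
apply/cvgnCP => e e0.
pose B := A / (nc z - t).
have q01 : 0 <= nc x / t < 1.
  by rewrite divr_ge0 ?nc_ge0 ?(ltW t0)//= ltr_pdivrMr// mul1r.
have [N0 N0P] := geom_small (B * nc x) q01 e0; exists N0 => n /N0P; apply: le_lt_trans.
rewrite sub0r ncN ncM ncX exprS expr_div_n.
have -> : B * nc x * (nc x ^+ n / t ^+ n) = B / t ^+ n * (nc x * nc x ^+ n) by ring.
rewrite ler_wpM2r ?mulr_ge0 ?exprn_ge0 ?nc_ge0// ler_pdivlMr ?exprn_gt0//.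
by apply: quot_coef_bound => //; rewrite (ltW t0).
Qed.

Lemma sums_on_shift (R : realType) (r : R) (c : nat -> Cplx R)
    (g : Cplx R -> Cplx R) :
  c 0%N = 0 -> sums_on r c g ->
  sums_on r (fun n => c n.+1) (fun w => if w == 0 then c 1%N else g w / w).
Proof.
move=> c0 gc x xr; have [->|x0] := eqVneq x 0.
  rewrite -(cvg_shiftS (fun N => psum _ N _)).
  rewrite (_ : (fun N => psum _ N.+1 0) = fun=> c 1%N); first exact: cvg_cst.
  apply/funext => N; rewrite /psum big_ord_recl expr0 mulr1 big1 ?addr0// => i _.
  by rewrite expr0n /= mulr0.
rewrite (_ : (fun N => _) = fun N => psum c N.+1 x / x); last first.
  apply/funext => N; rewrite /psum big_ord_recl c0 mul0r add0r mulr_suml.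
  by apply: eq_bigr => i _; rewrite exprSr -!mulrA mulfV// mulr1.
apply: cvgM; last exact: cvg_cst.
by rewrite (cvg_shiftS (fun N => psum c N x)); exact: gc.
Qed.

(** Each step trades one order of vanishing for one factor |z|: the quotient
    g(z)/z is at most 1/rho on the circle of radius rho, hence inside it, and
    rho is arbitrary below 1. *)
Lemma schwarz_lemma_order (R : realType) (k : nat) (g : Cplx R -> Cplx R) (r : R)
    (c : nat -> Cplx R) :
  (forall z, nc z < 1 -> analytic_at g z) ->
  (forall z, nc z < 1 -> nc (g z) <= 1) ->
  0 < r -> sums_on r c g -> (forall j, (j < k)%N -> c j = 0) ->
  forall z, nc z < 1 -> nc (g z) <= nc z ^+ k.
Proof.
elim: k g c => [|k IH] g c ag g1 r0 gc c0 z z1; first by rewrite expr0 g1.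
have g0 : g 0 = 0 by rewrite (sums_on0 r0 gc) c0.
pose G w : Cplx R := if w == 0 then c 1%N else g w / w.
have cG : sums_on r (fun n => c n.+1) G by apply: sums_on_shift => //; exact: c0.
have aG w : nc w < 1 -> analytic_at G w.
  move=> w1; have [->|w0] := eqVneq w 0; last by apply: analytic_at_quot => //; exact: ag.
  exists r, (fun n => c n.+1); split; first exact: r0.
  rewrite (_ : (fun x => G (x + 0)) = G); first exact: cG.
  by apply/funext => x; rewrite addr0.
have G1 w : nc w < 1 -> nc (G w) <= 1.
  move=> w1; rewrite leNgt; apply/negP => Gw.
  have w0 := nc_ge0 w.
  (* Below 1, but above |w| and above 1 / |G w|: the maximum principle on the
     disc of radius rho then contradicts the value of G at w. *)
  pose rho := Num.max ((nc w + 1) / 2) (((nc (G w))^-1 + 1) / 2).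
  have i1 : (nc (G w))^-1 < 1 by rewrite invf_lt1//; lra.
  have rho1 : rho < 1 by rewrite gt_max; apply/andP; split; lra.
  have rhow : (nc w + 1) / 2 <= rho by rewrite le_max lexx.
  have rhoG : ((nc (G w))^-1 + 1) / 2 <= rho by rewrite le_max lexx orbT.
  have rho0 : 0 < rho by lra.
  have : nc (G w) <= rho^-1.
    apply: (@max_modulus _ G rho); [exact: ltW| | |lra].
      by move=> v vr; apply: aG; lra.
    move=> v vr; have v0 : v != 0 by rewrite -nc_gt0 vr.
    rewrite /G (negbTE v0) ncM ncV vr ler_piMl ?invr_ge0 ?(ltW rho0)//.
    by apply: g1; rewrite vr.
  rewrite -ler_pV2 ?invrK ?inE ?unitfE ?gt_eqF ?invr_gt0//; lra.
have -> : g z = z * G z.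
  rewrite /G; have [->|z0] := eqVneq z 0; first by rewrite mul0r.
  by rewrite mulrC divfK.
rewrite ncM exprS ler_wpM2l ?nc_ge0//.
by apply: (IH G (fun n => c n.+1)) => // j jk; exact: c0.
Qed.

Lemma schwarz_class_le (R : realType) (k : nat) (g : Cplx R -> Cplx R)
    (h : Cplx R) :
  schwarz_class k g -> unit_disc R h -> nc (g h) <= nc h ^+ k.
Proof.
move=> [ag g1 gk _] h1.
have D0 : unit_disc R 0 by change (nc (0 : Cplx R) < 1); rewrite nc0 ltr01.
have [c /nbhsCP[r r0 gc]] := ag 0 D0.
have cg : sums_on r c g by move=> w wr; have := gc w; rewrite subr0 => /(_ wr).
apply: (schwarz_lemma_order (r := r) (c := c)) => // [z z1|j jk].
  exact: analytic_onP ag z1.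
have := gk j jk; rewrite (derive1n_at0 j r0 cg) => /eqP.
by rewrite mulf_eq0 pnatr_eq0 gtn_eqF ?fact_gt0//= => /eqP.
Qed.

(** * The inequality inside the radius *)

(** With s = (1 + 2 rho^2) / 2 < 1, the inequality s^2 >= 2 rho^2 is the one
    between arithmetic and geometric means for 1 and 2 rho^2. *)
Lemma bohr_inequality_disc (R : realType) (c : nat -> Cplx R) (F : Cplx R -> Cplx R)
    (rho : R) (N : nat) :
  sums_on 1 c F -> (forall w, nc w < 1 -> nc (F w) <= 1) ->
  0 <= rho -> 2 * rho ^+ 2 < 1 ->
  \sum_(n < N) nc (c n.+1) * rho ^+ n.+1 <= 1.
Proof.
move=> cF F1 rho0 rho1; pose s := (1 + 2 * rho ^+ 2) / 2.
have rr0 : 0 <= rho ^+ 2 := sqr_ge0 rho.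
have s0 : 0 < s by rewrite /s; lra.
have s1 : s < 1 by rewrite /s; lra.
have q12 : (rho / s) ^+ 2 <= 2^-1.
  rewrite expr_div_n ler_pdivrMr ?exprn_gt0// /s; nra.
have q0 : 0 <= rho / s by rewrite divr_ge0// ltW.
have B : \sum_(n < N) (nc (c n.+1) * s ^+ n.+1) ^+ 2 <= 1.
  have := bessel N.+1 cF (s := s) (M := 1); rewrite s0 s1 expr1n => /(_ isT).
  have F1s w : nc w = s -> nc (F w) <= 1 by move=> ws; rewrite F1// ws.
  move=> /(_ F1s); apply: le_trans; rewrite big_ord_recl lerDr; exact: sqr_ge0.
have Q : \sum_(n < N) ((rho / s) ^+ n.+1) ^+ 2 <= 1.
  have half : 0 <= (2^-1 : R) < 1 by apply/andP; split; lra.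
  have := sum_geom_le N half; rewrite (_ : (1 - 2^-1)^-1 = 2 :> R); last by field.
  move=> H; rewrite (@le_trans _ _ (\sum_(n < N) 2^-1 * 2^-1 ^+ n))//.
    apply: ler_sum => n _; rewrite -exprS exprAC lerXn2r// ?nnegrE ?sqr_ge0//; lra.
  rewrite -mulr_sumr; lra.
suff : \sum_(n < N) nc (c n.+1) * rho ^+ n.+1 <=
   \sum_(n < N) ((nc (c n.+1) * s ^+ n.+1) ^+ 2 + ((rho / s) ^+ n.+1) ^+ 2) / 2.
  by rewrite -mulr_suml big_split /=; lra.
apply: ler_sum => n _.
have -> : nc (c n.+1) * rho ^+ n.+1
    = (nc (c n.+1) * s ^+ n.+1) * (rho / s) ^+ n.+1.
  by rewrite [(rho / s) ^+ _]expr_div_n; field; rewrite expf_neq0// gt_eqF.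
move: (nc (c n.+1) * s ^+ n.+1) ((rho / s) ^+ n.+1) => x y.
by have := sqr_ge0 (x - y); rewrite sqrrB; lra.
Qed.

Section HomogeneousPolynomials.
Import -(notations) mpoly.

Lemma hpevalZ (R : realType) (d n : nat) (p : mpoly.mpoly d (Cplx R))
    (l : Cplx R) (z : 'rV[Cplx R]_d) :
  homogeneous n p -> hpeval p (l *: z) = l ^+ n * hpeval p z.
Proof.
move=> /mpoly.dhomogP pn; rewrite /hpeval !mpoly.mevalE mulr_sumr.
rewrite !big_seq; apply: eq_bigr => m mp.
rewrite mulrCA; congr (_ * _).
rewrite -(pn m mp) /= mdegE -prodrXr -big_split /=; apply: eq_bigr => i _.
by rewrite mxE exprMn.
Qed.

End HomogeneousPolynomials.

Lemma nneseries_le1P (R : realType) (x : nat -> R) :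
  (forall n, 0 <= x n) ->
  (\sum_(1 <= n <oo) (x n)%:E <= 1)%E <->
  forall N, \sum_(n < N) x n.+1 <= 1.
Proof.
move=> x0; split=> [H N|H].
  rewrite -lee_fin (le_trans _ H)// -sumEFin.
  have := @nneseries_lim_ge R (fun n => (x n)%:E) xpredT 1 N.+1.
  rewrite big_add1 /= big_mkord; apply=> n _ _; rewrite lee_fin//.
apply: lime_le; first by apply: is_cvg_nneseries => n _ _; rewrite lee_fin.
near=> N; rewrite sumEFin lee_fin.
case: (N) => [|n]; first by rewrite big_geq.
by rewrite big_add1 big_mkord.
Unshelve. all: by end_near. Qed.

Lemma radius_pow (R : realType) (k : nat) : (0 < k)%N ->
  (1 / 2 `^ (1 / (2 * k)%:R)) ^+ (2 * k) = 2^-1 :> R.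
Proof.
move=> k0; rewrite expr_div_n expr1n div1r -powR_mulrn ?powR_ge0// -powRrM.
by rewrite div1r mulVf ?powRr1// pnatr_eq0 muln_eq0 /= -lt0n.
Qed.

Lemma bohr_inequality_radius (R : realType) (d k : nat) (Q : set 'rV[Cplx R]_d)
    (f : 'rV[Cplx R]_d -> Cplx R) (P : nat -> mpoly.mpoly d (Cplx R))
    (omega : Cplx R -> Cplx R) :
  (0 < k)%N -> bounded_expansion Q f P -> schwarz_class k omega ->
  bohr_inequality_in Q P omega (1 / 2 `^ (1 / (2 * k)%:R)).
Proof.
move=> k0 [[_ Ph Pf] _ f1] ok b bQ h h1 hr.
have r2k := radius_pow R k0; set r0 := 1 / _ in hr r2k.
pose rho := nc (omega h).
have rho0 : 0 <= rho := nc_ge0 _.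
have rhoh : rho <= nc h ^+ k by exact: schwarz_class_le.
have rho1 : 2 * rho ^+ 2 < 1.
  have : rho ^+ 2 < 2^-1.
    rewrite -r2k (@le_lt_trans _ _ (nc h ^+ (2 * k)))//.
      by rewrite mulnC exprM lerXn2r// nnegrE ?exprn_ge0 ?nc_ge0.
    by rewrite ltrXn2r ?nc_ge0// muln_eq0 /= -lt0n.
  lra.
pose c n := hpeval (P n) b.
rewrite (eq_eseriesr (g := fun n => (nc (c n) * rho ^+ n)%:E)); last first.
  by move=> n _; rewrite (hpevalZ _ _ (Ph n)) ncM ncX mulrC.
apply/nneseries_le1P => [n|N]; first by rewrite mulr_ge0 ?exprn_ge0 ?nc_ge0.
apply: (@bohr_inequality_disc _ c (fun x => f (x *: b))) => //.
- move=> w w1; have := Pf _ (bQ w w1).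
  suff -> : psum c ^~ w = fun m => \sum_(n < m) hpeval (P n) (w *: b) by [].
  apply/funext => m.
  by apply: eq_bigr => n _; rewrite (hpevalZ _ _ (Ph n)) mulrC.
- by move=> w w1; rewrite ltW// f1//; exact: bQ.
Qed.

(** * The Hermitian product and closest points *)

Definition herm (R : realType) (d : nat) (v n : 'rV[Cplx R]_d) : Cplx R :=
  \sum_i v 0 i * conjc (n 0 i).

Definition sqn (R : realType) (d : nat) (v : 'rV[Cplx R]_d) : R :=
  \sum_i nc (v 0 i) ^+ 2.

Lemma ReD (R : realType) (a b : Cplx R) :
  complex.Re (a + b) = complex.Re a + complex.Re b.
Proof. by case: a b => [? ?] [? ?]. Qed.

Lemma ReM_real (R : realType) (t : R) (a : Cplx R) :
  complex.Re ((t%:C)%C * a) = t * complex.Re a.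
Proof. by case: a => [x y] /=; rewrite mul0r subr0. Qed.

Lemma Re_le_nc (R : realType) (a : Cplx R) : complex.Re a <= nc a.
Proof.
have := normc_ge_Re a; rewrite normE lecR; apply: le_trans.
exact: ler_norm.
Qed.

Lemma Re_sum (R : realType) (I : finType) (F : I -> Cplx R) :
  complex.Re (\sum_i F i) = \sum_i complex.Re (F i).
Proof. by elim/big_rec2: _ => // i x y _ <-; rewrite ReD. Qed.

Lemma nc_sqr (R : realType) (a : Cplx R) :
  nc a ^+ 2 = complex.Re a ^+ 2 + complex.Im a ^+ 2.
Proof. by case: a => x y /=; rewrite sqr_sqrtr// addr_ge0 ?sqr_ge0. Qed.

Lemma nc_sqrD_real (R : realType) (a b : Cplx R) (t : R) :
  nc (a + (t%:C)%C * b) ^+ 2 =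
  nc a ^+ 2 + 2 * t * complex.Re (b * conjc a) + t ^+ 2 * nc b ^+ 2.
Proof. by rewrite !nc_sqr; case: a b => [x y] [u v] /=; ring. Qed.

Lemma sqnD_real (R : realType) (d : nat) (v w : 'rV[Cplx R]_d) (t : R) :
  sqn (v + (t%:C)%C *: w) =
  sqn v + 2 * t * complex.Re (herm w v) + t ^+ 2 * sqn w.
Proof.
rewrite /sqn /herm Re_sum !mulr_sumr -!big_split /=; apply: eq_bigr => i _.
by rewrite !mxE nc_sqrD_real.
Qed.

Lemma hermB (R : realType) (d : nat) (v w n : 'rV[Cplx R]_d) :
  herm (v - w) n = herm v n - herm w n.
Proof. by rewrite /herm -sumrB; apply: eq_bigr => i _; rewrite !mxE mulrBl. Qed.

Lemma hermZ (R : realType) (d : nat) (l : Cplx R) (v n : 'rV[Cplx R]_d) :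
  herm (l *: v) n = l * herm v n.
Proof. by rewrite /herm mulr_sumr; apply: eq_bigr => i _; rewrite !mxE mulrA. Qed.

Lemma Re_herm_self (R : realType) (d : nat) (n : 'rV[Cplx R]_d) :
  complex.Re (herm n n) = sqn n.
Proof.
rewrite /herm Re_sum; apply: eq_bigr => i _; rewrite nc_sqr.
by case: (n 0 i) => x y /=; ring.
Qed.

Lemma sqn_gt0 (R : realType) (d : nat) (n : 'rV[Cplx R]_d) :
  n != 0 -> 0 < sqn n.
Proof.
move=> n0; have [i ni] : exists i, n 0 i != 0.
  by apply/existsP; apply: contraNT n0 => /existsPn n0; apply/eqP/rowP => i;
     rewrite mxE; have := n0 i; rewrite negbK => /eqP.
rewrite /sqn (bigD1 i)//= ltr_wpDr ?sumr_ge0// => [j _|]; first exact: sqr_ge0.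
by rewrite exprn_gt0// nc_gt0.
Qed.

Lemma nc_conj (R : realType) (a : Cplx R) : nc (conjc a) = nc a.
Proof. by case: a => x y /=; rewrite sqrrN. Qed.

Lemma nc_coord_le_sum (R : realType) (d : nat) (v : 'rV[Cplx R]_d) i :
  nc (v 0 i) <= \sum_j nc (v 0 j).
Proof. by rewrite (bigD1 i)//= lerDl sumr_ge0// => j _; exact: nc_ge0. Qed.

Lemma sum_nc_ge0 (R : realType) (d : nat) (v : 'rV[Cplx R]_d) :
  0 <= \sum_j nc (v 0 j).
Proof. by apply: sumr_ge0 => j _; exact: nc_ge0. Qed.

Lemma sqn_ge0 (R : realType) (d : nat) (v : 'rV[Cplx R]_d) : 0 <= sqn v.
Proof. by apply: sumr_ge0 => j _; exact: sqr_ge0. Qed.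

Lemma herm_le (R : realType) (d : nat) (e : R) (v n : 'rV[Cplx R]_d) :
  (forall i, nc (v 0 i) <= e) -> nc (herm v n) <= e * \sum_i nc (n 0 i).
Proof.
move=> ve; rewrite (le_trans (nc_sum _ _ _))// mulr_sumr ler_sum// => i _.
by rewrite ncM nc_conj ler_wpM2r ?nc_ge0.
Qed.

Lemma nbhs_rVP (R : realType) (d : nat) (z : 'rV[Cplx R]_d)
    (P : set 'rV[Cplx R]_d) :
  nbhs z P <->
  exists2 e : R, 0 < e & forall w : 'rV[Cplx R]_d,
    (forall i, nc (w 0 i - z 0 i) < e) -> P w.
Proof.
split=> [/nbhs_ballP[e /Cplx_gt0P[e0 ee] eP]|[e e0 eP]].
  exists (complex.Re e) => // w wz; apply: eP; split=> [|i j].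
    by rewrite ee ltcR.
  by rewrite -ball_normE /= ee normE ltcR ncB ord1.
apply/nbhs_ballP; exists (e%:C)%C; first by rewrite /= ltcR.
move=> w [_ H]; apply: eP => i; have := H 0 i.
by rewrite -ball_normE /= normE ltcR ncB.
Qed.

Lemma convex_setE (R : realType) (d : nat) (Q : set 'rV[Cplx R]_d)
    (u v : 'rV[Cplx R]_d) (t : R) :
  convex_set Q -> Q u -> Q v -> 0 <= t <= 1 ->
  Q ((t%:C)%C *: u + ((1 - t)%:C)%C *: v).
Proof.
move=> cQ Qu Qv /andP[t0 t1].
have t0' : 0 <= (t%:C)%C :> Cplx R by rewrite lecR.
have t1' : (t%:C)%C <= 1 :> Cplx R by rewrite lecR.
have /set_mem := cQ u v (Itv01 t0' t1') (mem_set Qu) (mem_set Qv).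
by rewrite rmorphB rmorph1.
Qed.

Lemma sqnB_continuous (R : realType) (d : nat) (y : 'rV[Cplx R]_d) :
  continuous (fun v : 'rV[Cplx R]_d => sqn (v - y)).
Proof.
rewrite /sqn; apply: continuous_big => [|i _ v]; first exact: add_continuous.
apply: (@continuous_comp _ _ _ (fun v : 'rV[Cplx R]_d => nc ((v - y) 0 i))
  (fun x : R => x ^+ 2)); last exact: exprn_continuous.
apply/(@cvgrPdist_lt _ _ _ (nbhs v) (nbhs_filter v)) => e e0.
apply/nbhs_rVP; exists e => // w /(_ i); apply: le_lt_trans.
rewrite ler_norml !mxE.
have := nc_le_add_dist (v 0 i - y 0 i) (w 0 i - y 0 i).
have := nc_le_add_dist (w 0 i - y 0 i) (v 0 i - y 0 i).
rewrite !opprB !subrKA (ncB (v 0 i) (w 0 i)); lra.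
Qed.

(** The points outside a large polydisc are farther from y than a given point
    a of A, so the minimum over a compact part of A is the minimum over A. *)
Lemma closest_point (R : realType) (d : nat) (A : set 'rV[Cplx R]_d)
    (y : 'rV[Cplx R]_d) :
  A !=set0 -> closed A ->
  exists2 p, A p & forall v, A v -> sqn (p - y) <= sqn (v - y).
Proof.
move=> [a Aa] clA.
pose S := \sum_i nc ((a - y) 0 i).
(* Large enough for the polydisc of radius B to contain a, and for the
   points outside it to be at distance at least S from y. *)
pose B := \sum_i nc (y 0 i) + S.
pose K := A `&` [set v | forall i, nc (v 0 i) <= B].
have Sle i : nc ((a - y) 0 i) <= S := nc_coord_le_sum _ i.
have yle i := nc_coord_le_sum y i.
have S0 : 0 <= S := sum_nc_ge0 _.
have aS : sqn (a - y) <= S ^+ 2.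
  rewrite expr2 {1}/S mulr_suml /sqn ler_sum// => i _.
  by rewrite expr2 ler_wpM2l ?nc_ge0.
have cK : compact K.
  rewrite /K setIC; apply: compact_closedI; last exact: clA.
  by apply: (@rV_compact (Cplx R) d (fun=> [set z | nc z <= B])) => i;
     exact: compact_disc.
have Ka : K a.
  split=> //= i; have := Sle i; rewrite mxE mxE => Si.
  by rewrite (le_trans (nc_le_add_dist _ (y 0 i)))// lerD.
have K0 : K !=set0 by exists a.
have [p /set_mem[Ap _] pmin] :=
  compact_EVT_min K0 cK (continuous_subspaceT (@sqnB_continuous R d y)).
exists p => // v Av; have [Kv|] := pselect (K v); first by apply: pmin; exact/mem_set.
move=> nKv; have [i vi] : exists i, B < nc (v 0 i).
  apply: contrapT => H; apply: nKv; split=> //= i; rewrite leNgt.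
  by apply/negP => vi; apply: H; exists i.
rewrite (le_trans (pmin _ (mem_set Ka)))// (le_trans aS)//.
rewrite /sqn (bigD1 i)//= -[leLHS]addr0 lerD//; last first.
  by rewrite sumr_ge0// => j _; exact: sqr_ge0.
rewrite lerXn2r ?nnegrE ?nc_ge0// !mxE.
by have := nc_le_add_dist (v 0 i) (y 0 i); have := yle i; rewrite /B in vi; lra.
Qed.

(** * A linear form supporting a convex circular domain *)

Lemma le0_of_le_small_multiple (R : realFieldType) (X T : R) :
  0 <= T -> (forall t, 0 < t -> t <= 1 -> 2 * X <= t * T) -> X <= 0.
Proof.
move=> T0 small; rewrite leNgt; apply/negP => X0.
(* For this t, t T < X, against 2 X <= t T. *)
pose t := Num.min 1 (X / (T + 1)).
have t0 : 0 < t by rewrite lt_min ltr01 divr_gt0//; lra.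
have t1 : t <= 1 by rewrite ge_min lexx.
have tX : t * (T + 1) <= X.
  by rewrite -ler_pdivlMr ?ge_min ?lexx ?orbT//; lra.
have := small t t0 t1; lra.
Qed.

(** If 2 z were close to a point q of Q, then z would be the midpoint of q and
    of 2 z - q, which is near 0 and so in Q. Working with 2 z instead of z
    provides a point at positive distance from Q. *)
Lemma dilate_notin_closure (R : realType) (d : nat) (Q : set 'rV[Cplx R]_d)
    (z : 'rV[Cplx R]_d) :
  open Q -> Q 0 -> convex_set Q -> ~ Q z -> ~ closure Q (2 *: z).
Proof.
move=> oQ Q0 cQ nQz clz; have /nbhs_rVP[e e0 eQ] := oQ _ Q0.
have near2z : nbhs (2 *: z) [set w : 'rV[Cplx R]_d | Q (2 *: z - w)].
  apply/nbhs_rVP; exists e => // w we; apply: eQ => i.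
  by have := we i; rewrite !mxE subr0 ncB.
have [q [Qq Qzq]] := clz _ near2z.
apply: nQz; have half01 : 0 <= (2^-1 : R) <= 1 by apply/andP; split; lra.
have := convex_setE cQ Qq Qzq half01.
have -> : 1 - 2^-1 = 2^-1 :> R by lra.
have h2 : ((2^-1)%:C)%C = 2^-1 :> Cplx R by rewrite fmorphV rmorph_nat.
by rewrite h2 -scalerDr subrKC scalerA mulVf ?scale1r// pnatr_eq0.
Qed.

Lemma closure_segment (R : realType) (d : nat) (Q : set 'rV[Cplx R]_d)
    (p q : 'rV[Cplx R]_d) (t : R) :
  convex_set Q -> closure Q p -> Q q -> 0 <= t <= 1 ->
  closure Q (p + (t%:C)%C *: (q - p)).
Proof.
move=> cQ clp Qq t01 B /nbhs_rVP[e e0 eB].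
have near_p : nbhs p [set w : 'rV[Cplx R]_d | forall i, nc (w 0 i - p 0 i) < e].
  by apply/nbhs_rVP; exists e.
have [p' [Qp' pp']] := clp _ near_p.
exists (((t%:C)%C *: q) + ((1 - t)%:C)%C *: p'); split; first exact: convex_setE.
apply: eB => i; rewrite !mxE.
have -> : (t%:C)%C * q 0 i + ((1 - t)%:C)%C * p' 0 i
    - (p 0 i + (t%:C)%C * (q 0 i - p 0 i)) = ((1 - t)%:C)%C * (p' 0 i - p 0 i).
  by rewrite rmorphB rmorph1; ring.
rewrite ncM nc_real (le_lt_trans _ (pp' i))// ler_piMl ?nc_ge0//.
by rewrite ger0_norm; lra.
Qed.

(** Rotating q makes herm q n real and nonnegative, so the bound on real parts
    bounds the modulus; it is strict because Q is open. It is positive because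
    Q contains a small multiple of n. *)
Lemma circular_bound (R : realType) (d : nat) (Q : set 'rV[Cplx R]_d)
    (n : 'rV[Cplx R]_d) (m : R) :
  complete_circular_domain Q -> n != 0 ->
  (forall q, Q q -> complex.Re (herm q n) <= m) ->
  0 < m /\ forall q, Q q -> nc (herm q n) < m.
Proof.
move=> [oQ _ Q0 circ] n0 Rem; have sn0 := sqn_gt0 n0.
pose S := \sum_i nc (n 0 i).
have S0 : 0 <= S := sum_nc_ge0 n.
have nS i : nc (n 0 i) <= S := nc_coord_le_sum n i.
clearbody S.
have m0 : 0 < m.
  have /nbhs_rVP[e e0 eQ] := oQ _ Q0.
  have S10 : 0 < S + 1 by lra.
  have eS : 0 < e / (S + 1) by rewrite divr_gt0.
  have /Rem : Q (((e / (S + 1))%:C)%C *: n).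
    apply: eQ => i; rewrite !mxE subr0 ncM nc_real gtr0_norm//.
    rewrite mulrAC ltr_pdivrMr// ltr_pM2l//; have := nS i; lra.
  rewrite hermZ ReM_real Re_herm_self; apply: lt_le_trans; exact: mulr_gt0.
have ncm q : Q q -> nc (herm q n) <= m.
  move=> Qq; have [->|w0] := eqVneq (herm q n) 0; first by rewrite nc0 ltW.
  set w := herm q n in w0 *.
  have nw0 : 0 < nc w by rewrite nc_gt0.
  pose l : Cplx R := conjc w / ((nc w)%:C)%C.
  have ncl : nc l = 1.
    by rewrite ncM ncV nc_conj nc_real gtr0_norm// mulfV// gt_eqF.
  have /Rem : Q (l *: q) by apply: circ => //; rewrite ncl.
  rewrite hermZ -/w; suff -> : l * w = ((nc w)%:C)%C by [].
  rewrite /l mulrAC -[in LHS]normE [conjc w * w]mulrC -sqr_normc expr2.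
  by rewrite mulfK ?normr_eq0// normE.
have ncmS q : Q q -> nc (herm q n) < m.
  move=> Qq; have /nbhs_rVP[e e0 eQ] := oQ _ Qq.
  pose T := \sum_i nc (q 0 i).
  have T0 : 0 <= T := sum_nc_ge0 q.
  have qT i : nc (q 0 i) <= T := nc_coord_le_sum q i.
  clearbody T.
  have T10 : 0 < T + 1 by lra.
  have eT : 0 < e / (T + 1) by rewrite divr_gt0.
  have /ncm : Q (((1 + e / (T + 1))%:C)%C *: q).
    apply: eQ => i; rewrite !mxE rmorphD rmorph1 mulrDl mul1r addrAC subrr add0r.
    rewrite ncM nc_real gtr0_norm//.
    rewrite mulrAC ltr_pdivrMr// ltr_pM2l//; have := qT i; lra.
  rewrite hermZ ncM nc_real gtr0_norm; last by lra.
  have := nc_ge0 (herm q n); rewrite le_eqVlt => /orP[/eqP <- //|w0]; nra.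
by split.
Qed.

Lemma nc_herm_scale (R : realType) (d : nat) (z n : 'rV[Cplx R]_d) (m : R) :
  0 < m -> nc (herm z ((m^-1%:C)%C *: n)) = nc (herm z n) / m.
Proof.
move=> m0; rewrite (_ : herm _ _ = (m^-1%:C)%C * herm z n).
  by rewrite ncM nc_real gtr0_norm ?invr_gt0// mulrC.
rewrite /herm mulr_sumr; apply: eq_bigr => i _; rewrite mxE rmorphM /= mulrCA.
by rewrite oppr0.
Qed.

Lemma herm_approx (R : realType) (d : nat) (Q : set 'rV[Cplx R]_d)
    (p n : 'rV[Cplx R]_d) (e : R) :
  closure Q p -> 0 < e -> exists2 q, Q q & nc (herm (q - p) n) < e.
Proof.
move=> clp e0; pose S := \sum_i nc (n 0 i); have S0 : 0 <= S := sum_nc_ge0 n.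
have S1 : 0 < S + 1 by lra.
pose e' := e / (S + 1); have e'0 : 0 < e' by rewrite divr_gt0.
have near_p : nbhs p [set w : 'rV[Cplx R]_d | forall i, nc (w 0 i - p 0 i) < e'].
  by apply/nbhs_rVP; exists e'.
have [q [Qq pq]] := clp _ near_p; exists q => //.
have small : nc (herm (q - p) n) <= e' * S.
  by apply: herm_le => i; rewrite !mxE; exact: ltW (pq i).
apply: (le_lt_trans small); rewrite /e' mulrAC ltr_pdivrMr// ltr_pM2l//.
by rewrite ltrDl.
Qed.

(** If p is the point of the closure of Q closest to y, moving from p towards
    any q in Q cannot decrease the distance to y, so that
    Re herm (q - p) (y - p) <= 0. Approximating p from inside Q shows that the
    normalized form has supremum 1. *)
Lemma support_functional (R : realType) (d : nat) (Q : set 'rV[Cplx R]_d) :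
  complete_circular_domain Q -> convex_set Q -> Q <> setT ->
  exists n : 'rV[Cplx R]_d,
    (forall z, Q z -> nc (herm z n) < 1) /\
    (forall x, x < 1 -> exists2 z, Q z & x < nc (herm z n)).
Proof.
move=> QD cQ QT; have [oQ _ Q0 _] := QD.
have [z0 nQ0] : exists z0, ~ Q z0.
  apply: contrapT => H; apply: QT; apply/seteqP; split=> // z _.
  by apply: contrapT => nQz; apply: H; exists z.
pose y := 2 *: z0; have ny : ~ closure Q y by exact: dilate_notin_closure.
have clQ0 : closure Q !=set0 by exists 0; exact: subset_closure.
have [p clp pmin] := closest_point y clQ0 (@closed_closure _ Q).
pose n := y - p.
have n0 : n != 0.
  by rewrite subr_eq0; apply/eqP => yp; apply: ny; rewrite yp.
have py : p - y = - n by rewrite opprB.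
clearbody n; have sn0 := sqn_gt0 n0.
pose m := complex.Re (herm p n).
have Rem q : Q q -> complex.Re (herm q n) <= m.
  move=> Qq; rewrite -subr_le0 /m.
  have -> : complex.Re (herm q n) - complex.Re (herm p n)
      = complex.Re (herm (q - p) n).
    by rewrite hermB -[X in _ = complex.Re (X - _)](subrK (herm p n)) addrK;
       case: (herm q n) (herm p n) => [? ?] [? ?].
  set X := complex.Re _; apply: (@le0_of_le_small_multiple _ X (sqn (q - p))); first exact: sqn_ge0.
  move=> t t0 t1; have t01 : 0 <= t <= 1 by rewrite ltW.
  have := pmin _ (closure_segment cQ clp Qq t01).
  rewrite addrAC sqnD_real.
  have -> : complex.Re (herm (q - p) (p - y)) = - X.
    rewrite /X py.
    rewrite /herm !Re_sum -sumrN; apply: eq_bigr => i _.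
    by rewrite [(- n) 0 i]mxE; case: (n 0 i) ((q - p) 0 i) => [? ?] [? ?] /=; ring.
  rewrite expr2 => H; rewrite -(ler_pM2l t0); lra.
have H1 : m <= nc (herm p n) := Re_le_nc _.
clearbody m; have [m0 ncmS] := circular_bound QD n0 Rem; clear pmin Rem.
exists ((m^-1%:C)%C *: n); split=> [z Qz|x x1].
  by rewrite (nc_herm_scale _ _ m0) (ltr_pdivrMr _ _ m0) mul1r; exact: ncmS.
have e0 : 0 < (1 - x) * m by rewrite mulr_gt0 ?subr_gt0.
have [q Qq pq] := herm_approx n clp e0; exists q; first exact: Qq.
rewrite (nc_herm_scale _ _ m0) (ltr_pdivlMr _ _ m0).
have := nc_le_add_dist (herm p n) (herm q n); rewrite ncB -hermB => H2.
rewrite mulrBl mul1r in pq; have := le_trans H1 H2; lra.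
Qed.

(** * Sharpness of the radius *)

(** The Taylor coefficients of extr_fun a, when a^2 = 1/2. *)
Definition extr_coef (R : realType) (a : R) (n : nat) : Cplx R :=
  if n is m.+1 then (if m is 0 then (a%:C)%C else - ((a%:C)%C ^+ n)) else 0.

Definition extr_fun (R : realType) (a : R) (z : Cplx R) : Cplx R :=
  ((a%:C)%C * z - z * z) / (1 - (a%:C)%C * z).

Lemma nc_extr_coef (R : realType) (a : R) (n : nat) :
  0 <= a -> nc (extr_coef a n.+1) = a ^+ n.+1.
Proof.
by case: n => [|n] a0; rewrite /extr_coef ?ncN ?ncX nc_real ger0_norm// expr1.
Qed.

Lemma extr_fun_den (R : realType) (a : R) (z : Cplx R) :
  0 <= a < 1 -> nc z < 1 -> 1 - (a%:C)%C * z != 0.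
Proof.
move=> /andP[a0 a1] z1; rewrite subr_eq0; apply: contraTneq z1 => az.
have : nc ((a%:C)%C * z) = 1 by rewrite -az nc1.
rewrite ncM nc_real ger0_norm// -leNgt => H.
have := nc_ge0 z; nra.
Qed.

Lemma extr_fun_lt1 (R : realType) (a : R) (z : Cplx R) :
  0 <= a < 1 -> nc z < 1 -> nc (extr_fun a z) < 1.
Proof.
move=> a01 z1; have den := extr_fun_den a01 z1; case/andP: a01 => a0 a1.
rewrite /extr_fun -mulrBl ncM ncV ltr_pdivrMr ?nc_gt0// mul1r ncM.
have den0 : 0 < nc (1 - (a%:C)%C * z) by rewrite nc_gt0.
have blaschke : nc ((a%:C)%C - z) <= nc (1 - (a%:C)%C * z).
  rewrite -(ler_pXn2r (n := 2)) ?nnegrE ?nc_ge0// !nc_sqr.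
  have : nc z ^+ 2 < 1 by rewrite expr_lt1 ?nc_ge0.
  rewrite nc_sqr; case: (z) => x y /= xy.
  have a21 : 0 <= 1 - a ^+ 2 by rewrite subr_ge0 exprn_ile1// ltW.
  have xy1 : 0 <= 1 - (x ^+ 2 + y ^+ 2) by lra.
  by have := mulr_ge0 a21 xy1; lra.
have := nc_ge0 z; nra.
Qed.

(** With t = a z, the hypothesis on a gives z^2 = 2 t^2, and the partial sums
    are t - t^2 - ... - t^(N+1). *)
Lemma extr_sums (R : realType) (a : R) :
  0 <= a < 1 -> a ^+ 2 = 2^-1 -> sums_on 1 (extr_coef a) (extr_fun a).
Proof.
move=> a01 a2 z z1; have den := extr_fun_den a01 z1; case/andP: a01 => a0 a1.
set t := (a%:C)%C * z in den.
have tz : 2 * t ^+ 2 = z * z.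
  rewrite /t exprMn -rmorphXn a2 fmorphV rmorph_nat.
  by rewrite mulrA mulfV ?pnatr_eq0// mul1r expr2.
have part N : psum (extr_coef a) N.+2 z = (t - z * z + t ^+ N.+2) / (1 - t).
  apply: (canRL (mulfK den)); rewrite -tz; elim: N => [|N IH].
    by rewrite /psum big_ord_recl big_ord1 /= mul0r add0r expr1 -/t; ring.
  rewrite psumS mulrDl IH /= mulNr -exprMn -/t !exprS; ring.
rewrite -(cvg_shiftS (fun N => psum _ N z)) -(cvg_shiftS (fun N => psum _ N.+1 z)).
rewrite (_ : (fun N => _) = fun N => (t - z * z + t ^+ N.+2) / (1 - t)); last first.
  exact/funext.
apply: cvgM; last exact: cvg_cst.
rewrite -[X in _ --> X]addr0; apply: cvgD; first exact: cvg_cst.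
apply/cvgnCP => e e0.
have nt : nc t = a * nc z by rewrite ncM nc_real ger0_norm.
have q01 : 0 <= nc t < 1 by rewrite nc_ge0 nt; have := nc_ge0 z; nra.
have [N0 N0P] := geom_small 1 q01 e0; exists N0 => n Nn.
by rewrite sub0r ncN ncX; have := N0P n.+2; rewrite mul1r; apply; rewrite !leqW.
Qed.

Lemma psum_finite (R : realType) (c : nat -> Cplx R) (m : nat) (w : Cplx R) :
  (forall n, (m <= n)%N -> c n = 0) -> psum c N w @[N --> \oo] --> psum c m w.
Proof.
move=> c0; have st j : psum c (m + j) w = psum c m w.
  elim: j => [|j IH]; first by rewrite addn0.
  by rewrite addnS psumS IH c0 ?leq_addr// mul0r addr0.
apply/cvgnCP => e e0; exists m => n mn.
by rewrite -(subnKC mn) st subrr nc0.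
Qed.

Lemma schwarz_class_pow (R : realType) (k : nat) :
  schwarz_class k (fun h : Cplx R => h ^+ k).
Proof.
have sk : sums_on 1 (fun n => (n == k)%:R) (fun h : Cplx R => h ^+ k).
  move=> w _; rewrite (_ : w ^+ k = psum (fun n => (n == k)%:R) k.+1 w).
    by apply: psum_finite => n kn; rewrite gtn_eqF.
  rewrite psumS eqxx mul1r /psum big1 ?add0r// => i _.
  by rewrite ltn_eqF// mul0r.
split=> [z _|h h1|j jk|].
- pose c n : Cplx R := z ^+ (k - n) *+ 'C(k, n); exists c.
  apply/nbhsCP; exists 1 => // w _; rewrite (_ : w ^+ k = psum c k.+1 (w - z)).
    by apply: psum_finite => n kn; rewrite /c bin_small.
  rewrite -[in LHS](subrKC z w) exprDn; apply: eq_bigr => i _.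
  by rewrite /c mulrnAl.
- by rewrite ncX exprn_ile1 ?nc_ge0// ltW.
- by rewrite (derive1n_at0 j ltr01 sk) ltn_eqF// mulr0.
- by rewrite (derive1n_at0 k ltr01 sk) eqxx mulr1 pnatr_eq0 gtn_eqF ?fact_gt0.
Qed.

Section LinearFormPowers.
Import -(notations) mpoly.

(** The homogeneous polynomial c L^n, for the linear form L = herm _ v. *)
Definition form_pow (R : realType) (d : nat) (v : 'rV[Cplx R]_d)
    (c : Cplx R) (n : nat) : mpoly.mpoly d (Cplx R) :=
  c *: (\sum_i conjc (v 0 i) *: mpolyX (Cplx R) (mnm1 i)) ^+ n.

Lemma form_pow_homogeneous (R : realType) (d : nat) (v : 'rV[Cplx R]_d)
    (c : Cplx R) (n : nat) : homogeneous n (form_pow v c n).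
Proof.
rewrite /homogeneous /form_pow; apply: dhomogZ.
rewrite -[X in ishomog1 X]mul1n; apply: dhomogMn.
apply: rpred_sum => i _; apply: dhomogZ.
by rewrite dhomogX /= mdeg1.
Qed.

Lemma hpeval_form_pow (R : realType) (d : nat) (v z : 'rV[Cplx R]_d)
    (c : Cplx R) (n : nat) : hpeval (form_pow v c n) z = c * herm z v ^+ n.
Proof.
rewrite /hpeval /form_pow mevalZ rmorphXn; congr (_ * _ ^+ _).
rewrite raddf_sum; apply: eq_bigr => i _.
by rewrite /= mevalZ mevalXU mulrC.
Qed.

End LinearFormPowers.

Lemma herm_differentiable (R : realType) (d : nat) (v z : 'rV[Cplx R]_d) :
  differentiable (fun w => herm w v) z.
Proof.
rewrite (_ : (fun w => herm w v) = \sum_i (fun w : 'rV[Cplx R]_d => w 0 i * conjc (v 0 i))).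
  apply: differentiable_sum => i.
  by apply: differentiableM => //; exact: differentiable_coord.
by apply/funext => w; rewrite fct_sumE.
Qed.

Lemma extr_bounded_expansion (R : realType) (d : nat) (Q : set 'rV[Cplx R]_d)
    (v : 'rV[Cplx R]_d) (a : R) :
  0 <= a < 1 -> a ^+ 2 = 2^-1 -> Q 0 -> (forall z, Q z -> nc (herm z v) < 1) ->
  bounded_expansion Q (fun z => extr_fun a (herm z v))
    (fun n => form_pow v (extr_coef a n) n).
Proof.
move=> a01 a2 Q0 v1; split=> [|| z Qz]; first split.
- move=> z Qz; have dz := herm_differentiable v z.
  rewrite /extr_fun; apply: differentiableM.
    by apply: differentiableB; apply: differentiableM.
  apply: differentiableV; last by apply: extr_fun_den => //; exact: v1.
  by apply: differentiableB => //; apply: differentiableM.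
- by move=> n; exact: form_pow_homogeneous.
- move=> z Qz; have := extr_sums a01 a2 (v1 z Qz).
  suff -> : psum (extr_coef a) ^~ (herm z v) =
    fun N => \sum_(n < N) hpeval (form_pow v (extr_coef a n) n) z by [].
  by apply/funext => N; apply: eq_bigr => n _; rewrite hpeval_form_pow.
- by apply: extr_fun_lt1 => //; exact: v1.
- by apply: extr_fun_lt1 => //; exact: v1.
Qed.

Lemma geom_sum_gt1 (R : realType) (q : R) :
  2^-1 < q < 1 -> exists N, 1 < \sum_(n < N) q ^+ n.+1.
Proof.
move=> /andP[q2 q1]; have q01 : 0 <= q < 1 by apply/andP; split; lra.
have e0 : 0 < 2 * q - 1 by lra.
have [N /(_ N (leqnn N)) NP] := geom_small q q01 e0; exists N.
have q10 : 0 < 1 - q by lra.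
rewrite -(ltr_pM2l q10) mulr1 (eq_bigr (fun n : 'I_N => q * q ^+ n)).
  rewrite -mulr_sumr mulrCA -[1 - q]opprB mulNr -subrX1 !opprB mulrBr mulr1; lra.
by move=> n _; rewrite exprS.
Qed.

(** * The Bohr radius *)

(* In convex_set, the coefficients {i01 Cplx R} range over the real segment
   [0, 1], since 0 <= t <= 1 in Cplx R forces t to be real. *)
Theorem theorem2p2 (R : realType) (d k : nat) (hd : (0 < d)%N) (hk : (0 < k)%N)
    (Q : set 'rV[Cplx R]_d) (hQ : complete_circular_domain Q) :
  let r0 : R := 1 / 2 `^ (1 / (2 * k)%:R) in
  (forall (f : 'rV[Cplx R]_d -> Cplx R) (P : nat -> mpoly.mpoly d (Cplx R))
      (omega : Cplx R -> Cplx R),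
    bounded_expansion Q f P -> schwarz_class k omega ->
    bohr_inequality_in Q P omega r0)
  /\
  (convex_set Q -> Q <> setT ->
    forall r : R, r0 < r -> r <= 1 ->
    exists (f : 'rV[Cplx R]_d -> Cplx R) (P : nat -> mpoly.mpoly d (Cplx R))
      (omega : Cplx R -> Cplx R),
      [/\ bounded_expansion Q f P, schwarz_class k omega
        & ~ bohr_inequality_in Q P omega r]).
Proof.
move=> r0; split=> [f P omega|cQ QT r r0r r1]; first exact: bohr_inequality_radius.
have [_ _ Q0 circ] := hQ.
have r2k : r0 ^+ (2 * k) = 2^-1 by exact: radius_pow.
have r00 : 0 <= r0 by rewrite /r0 divr_ge0 ?powR_ge0.
clearbody r0.
pose a : R := Num.sqrt 2^-1.
have a0 : 0 < a by rewrite sqrtr_gt0; lra.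
have a2 : a ^+ 2 = 2^-1 by rewrite sqr_sqrtr//; lra.
have a1 : a < 1 by nra.
have a01 : 0 <= a < 1 by rewrite ltW.
clearbody a.
(* omega(h) = h^k is evaluated at h = t, strictly between the two radii, to
   leave room for |L(b)| < 1. *)
pose t := (r0 + r) / 2.
have tr0 : r0 < t by rewrite /t; lra.
have tr : t < r by rewrite /t; lra.
have t0 : 0 < t by lra.
have tk0 : 0 < t ^+ k by rewrite exprn_gt0.
have ak : a < t ^+ k.
  rewrite -(ltr_pXn2r (n := 2)) ?nnegrE ?(ltW a0) ?(ltW tk0)//.
  rewrite a2 -r2k mulnC exprM -!exprM ltrXn2r//.
  by rewrite muln_eq0 /= orbF -lt0n.
have [v [v1 vsup]] := support_functional hQ cQ QT.
have [b Qb] : exists2 b, Q b & a / t ^+ k < nc (herm b v).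
  by apply: vsup; rewrite ltr_pdivrMr// mul1r.
rewrite ltr_pdivrMr// => ab.
exists (fun z => extr_fun a (herm z v)), (fun n => form_pow v (extr_coef a n) n),
  (fun h => h ^+ k).
split; [exact: extr_bounded_expansion|exact: schwarz_class_pow|].
have bD (h : Cplx R) : unit_disc R h -> Q (h *: b) by move=> /ltW; exact: circ.
have nct : nc ((t%:C)%C : Cplx R) = t by rewrite nc_real gtr0_norm.
have tD : unit_disc R (t%:C)%C.
  by change (nc ((t%:C)%C : Cplx R) < 1); rewrite nct; lra.
move=> /(_ b bD _ tD); rewrite nct => /(_ tr) /nneseries_le1P H.
pose q := a * (nc (herm b v) * t ^+ k).
have q12 : 2^-1 < q < 1.
  have rho1 : nc (herm b v) * t ^+ k < 1.
    rewrite (lt_le_trans (y := 1 * t ^+ k)) ?ltr_pM2r ?v1//.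
    by rewrite mul1r exprn_ile1 ?(ltW t0)//; lra.
  by rewrite /q -a2 expr2 ltr_pM2l// ab /=; nra.
have [N] := geom_sum_gt1 q12; apply/negP; rewrite -leNgt.
rewrite (le_trans _ (H _ N))// => [|n]; last exact: nc_ge0.
apply: ler_sum => n _; rewrite hpeval_form_pow hermZ ncM ncX nc_extr_coef ?(ltW a0)//.
by rewrite ncM ncX nct -exprMn [t ^+ k * _]mulrC.
Qed.
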